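(* A non-planar bicycling geodesic front track in $\mathbb{R}^3$ (with fixed frame length $1$) may not be rescaled: if $\mathbf{x}(t)$ is a non-planar front track, parametrized by arc length, of a bicycling geodesic in $\mathbb{R}^3$, and $\lambda>0$, $\lambda\ne1$, then the rescaled curve $\tilde{\mathbf{x}}(t)=\lambda\,\mathbf{x}(t/\lambda)$ is not the front track of a bicycling geodesic.
   Context: A bicycle path in $\mathbb{R}^3$ is a pair of curves $(\mathbf{x}(t),\mathbf{y}(t))$ (front and back tracks) such that $\mathbf{v}:=\mathbf{x}-\mathbf{y}$ satisfies $|\mathbf{v}|=1$ (frame length $1$) and $\mathbf{y}'\parallel\mathbf{v}$ for all $t$. Its length is the length of its front track. A bicycling geodesic is a bicycle path whose length between any two of its placements $(\mathbf{x},\mathbf{y})$ is critical among bicycle paths connecting these placements. A front track is non-planar if it is not contained in a plane. *)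

(* Defs.v *)
From Stdlib Require Import Reals.
From Coquelicot Require Import Coquelicot.

Open Scope R_scope.

(* Coquelicot's norm on a product is the l^2 combination of the norms of the
   factors, so [norm] on [E3] is the Euclidean norm (see [norm_E3]). *)
Definition E3 : Type := (R * R * R)%type.

Definition crd1 (p : E3) : R := fst (fst p).
Definition crd2 (p : E3) : R := snd (fst p).
Definition crd3 (p : E3) : R := snd p.

Definition dot (p q : E3) : R :=
  crd1 p * crd1 q + crd2 p * crd2 q + crd3 p * crd3 q.

Lemma norm_E3 (p : R * R * R) : norm p = sqrt (dot p p).
Proof.
destruct p as [[a b] c].
change (sqrt (sqrt (Rabs a ^ 2 + Rabs b ^ 2) ^ 2 + Rabs c ^ 2)
        = sqrt (a * a + b * b + c * c)).
rewrite pow2_sqrt.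
- rewrite !pow2_abs; f_equal; ring.
- apply Rplus_le_le_0_compat; apply pow2_ge_0.
Qed.

(* Connected subset of R: it may be open, closed, half-open or unbounded. *)
Definition is_interval (J : R -> Prop) : Prop :=
  forall a b t : R, J a -> J b -> a <= t <= b -> J t.

Definition segment (a b : R) : R -> Prop := fun t => a <= t <= b.

(* A curve defined on an interval J is represented by a total function.  It is
   smooth on J when it is C^infinity on a neighbourhood of every point of J;
   its values outside J are only an arbitrary smooth extension past the
   endpoints belonging to J, if there are any. *)
Definition smooth_at (f : R -> R) (t : R) : Prop :=
  locally t (fun u => forall n : nat, ex_derive_n f n u).

Definition smooth_curve (J : R -> Prop) (g : R -> E3) : Prop :=
  forall t, J t ->
    smooth_at (fun u => crd1 (g u)) t /\
    smooth_at (fun u => crd2 (g u)) t /\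
    smooth_at (fun u => crd3 (g u)) t.

(* Joint C^infinity smoothness in both variables. *)
Definition smooth2_at (f : R -> R -> R) (s t : R) : Prop :=
  locally_2d (fun u v => forall n : nat, ex_diff_n f n u v) s t.

Definition smooth_family_at (G : R -> R -> E3) (s t : R) : Prop :=
  smooth2_at (fun u v => crd1 (G u v)) s t /\
  smooth2_at (fun u v => crd2 (G u v)) s t /\
  smooth2_at (fun u v => crd3 (G u v)) s t.

Definition velocity (g : R -> E3) (t : R) : E3 :=
  (Derive (fun u => crd1 (g u)) t,
   Derive (fun u => crd2 (g u)) t,
   Derive (fun u => crd3 (g u)) t).

Definition speed (g : R -> E3) (t : R) : R :=
  norm (velocity g t : R * R * R).

Definition curve_length (g : R -> E3) (a b : R) : R := RInt (speed g) a b.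

Definition arc_length_parametrized (J : R -> Prop) (g : R -> E3) : Prop :=
  forall t, J t -> speed g t = 1.

(* The pair (front track x, back track y), with frame length 1.  The back track
   may have zero velocity (cusps are allowed). *)
Definition bicycle_path (J : R -> Prop) (x y : R -> E3) : Prop :=
  smooth_curve J x /\ smooth_curve J y /\
  forall t, J t ->
    norm (minus (x t) (y t) : R * R * R) = 1 /\
    exists c : R, velocity y t = scal c (minus (x t) (y t) : R * R * R).

(* (X s, Y s), |s| < eps, is a smooth one-parameter family of bicycle paths on
   [a, b], all connecting the placements (x a, y a) and (x b, y b), which is
   equal to (x, y) at s = 0. *)
Definition bicycle_variation (a b : R) (x y : R -> E3) (eps : posreal)
    (X Y : R -> R -> E3) : Prop :=
  (forall s t, Rabs s < eps -> segment a b t ->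
     smooth_family_at X s t /\ smooth_family_at Y s t) /\
  (forall s, Rabs s < eps -> bicycle_path (segment a b) (X s) (Y s)) /\
  (forall s, Rabs s < eps ->
     X s a = x a /\ Y s a = y a /\ X s b = x b /\ Y s b = y b) /\
  (forall t, segment a b t -> X 0 t = x t /\ Y 0 t = y t).

(* The length of a bicycle path is that of its front track. *)
Definition critical_between (a b : R) (x y : R -> E3) : Prop :=
  forall (eps : posreal) (X Y : R -> R -> E3),
    bicycle_variation a b x y eps X Y ->
    is_derive (fun s : R => curve_length (X s) a b) 0 0.

Definition bicycling_geodesic (J : R -> Prop) (x y : R -> E3) : Prop :=
  bicycle_path J x y /\
  forall a b, J a -> J b -> a < b -> critical_between a b x y.

Definition geodesic_front_track (J : R -> Prop) (x : R -> E3) : Prop :=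
  exists y : R -> E3, bicycling_geodesic J x y.

Definition planar (J : R -> Prop) (x : R -> E3) : Prop :=
  exists (n : E3) (c : R),
    n <> (0, 0, 0) /\ forall t, J t -> dot n (x t) = c.

Definition rescaled_domain (lam : R) (J : R -> Prop) : R -> Prop :=
  fun t => J (t / lam).

Definition rescaled (lam : R) (x : R -> E3) : R -> E3 :=
  fun t => scal lam (x (t / lam) : R * R * R).

(* Main.v *)
Require Import Defs.
From Stdlib Require Import Reals Lra Lia FunctionalExtensionality Classical.
From Coquelicot Require Import Coquelicot.

(** Write T = x' for the velocity of the front track and v = x - y for the
    frame, a unit vector.  The bicycle constraint y' = c v says that a bicycle
    path amounts to a curve v on the unit sphere together with a scalar
    function c, the placements at both ends being prescribed by the end values
    of v and by the vector condition that the integral of c v is y(b) - y(a).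

    Derivation of the equations of motion.  When x is not planar, v spans the
    space, so that this vector condition can be restored after any variation
    of v and c by adding to c a combination of the coordinates of v
    ([steering]).  Criticality of the length then yields a constant vector p,
    the Lagrange multiplier of the condition, such that q = T - p satisfies
    q . v = 0 and T' = (p . v) q - (q . T) v ([euler_lagrange],
    [geodesic_normal_extremal]).

    Invariants.  Along such a curve d = det (p, v, q) is constant.  If d = 0
    the direction of v x q is constant and normal to T, so x is planar.
    Otherwise, with P = |p|^2 and K = |T'|^2, the squared curvature,
    - |q|^2 = K + d^2,
    - 2 det (T, T', T'') = d (K - d^2 - 1 + P), which says that x is a
      Kirchhoff rod, and
    - K' ^ 2 = 4 Q (P Q - d^2) - Q (1 - Q - P)^2 where Q = K + d^2;
    moreover if K is constant then K = 1 (a helix).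

    Rescaling.  Dividing lengths by r multiplies K by r^2, det (T, T', T'') by
    r^3 and K' by r^3.  If K is constant, the last remark gives r^2 = 1.
    Otherwise K takes two values; comparing the second relation for x and its
    rescaling at both values forces d' = r d and P' - 1 = r^2 (P - 1) for the
    constants of the rescaled curve, and the third relation then reads
    (1 - r^2) K = 0, whence r = 1 ([rod_relations_rescale]). *)

Open Scope R_scope.

(** * Smooth functions on an open interval *)
Definition smooth_on (l u : R) (f : R -> R) : Prop :=
  forall t, l < t < u -> forall n, ex_derive_n f n t.

Lemma locally_between (l u t : R) (P : R -> Prop) :
  l < t < u -> (forall z, l < z < u -> P z) -> locally t P.
Proof.
intros [H1 H2] H.
assert (Hd : 0 < Rmin (t - l) (u - t)) by (apply Rmin_pos; lra).
exists (mkposreal _ Hd); intros z Hz.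
apply H.
change (Rabs (z - t) < Rmin (t - l) (u - t)) in Hz.
assert (A := Rmin_l (t - l) (u - t)); assert (B := Rmin_r (t - l) (u - t)).
apply Rabs_def2 in Hz; lra.
Qed.

(** Smoothness is coinductive: a class of functions each of whose members has
    its derivative in the class consists of smooth functions.  This replaces
    Leibniz formulas for higher derivatives. *)
Lemma smooth_on_coind (l u : R) (P : (R -> R) -> Prop) :
  (forall f, P f -> exists g, P g /\
     forall t, l < t < u -> is_derive f t (g t)) ->
  forall f, P f -> smooth_on l u f.
Proof.
intros HP f Pf t Ht n; revert f Pf t Ht.
induction n as [|n IH]; intros f Pf t Ht; [exact I|].
destruct (HP f Pf) as [g [Pg Hg]].
destruct n as [|n]; [exists (g t); exact (Hg t Ht)|].
apply ex_derive_ext_loc with (f := Derive_n g n).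
2: exact (IH g Pg t Ht).
apply (locally_between l u); [assumption|]; intros z Hz.
rewrite <- (Nat.add_1_r n), <- Derive_n_comp.
apply Derive_n_ext_loc, (locally_between l u); [assumption|].
intros w Hw; symmetry; apply is_derive_unique, Hg, Hw.
Qed.

Lemma smooth_on_Derive (l u : R) (f : R -> R) :
  smooth_on l u f -> smooth_on l u (Derive f).
Proof.
intros Hf t Ht [|n]; [exact I|].
apply ex_derive_ext with (f := Derive_n f (S n)); [|exact (Hf t Ht (S (S n)))].
intro z; rewrite <- (Nat.add_1_r n), <- Derive_n_comp; reflexivity.
Qed.

Lemma smooth_on_is_derive (l u : R) (f : R -> R) (t : R) :
  smooth_on l u f -> l < t < u -> is_derive f t (Derive f t).
Proof. intros Hf Ht; apply Derive_correct; exact (Hf t Ht 1%nat). Qed.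

Lemma smooth_on_continuous (l u : R) (f : R -> R) (t : R) :
  smooth_on l u f -> l < t < u -> continuous f t.
Proof.
intros Hf Ht; apply (ex_derive_continuous (K := R_AbsRing) (V := R_NormedModule)).
exact (Hf t Ht 1%nat).
Qed.

Lemma smooth_on_mono (l u l' u' : R) (f : R -> R) :
  l <= l' -> u' <= u -> smooth_on l u f -> smooth_on l' u' f.
Proof. intros H1 H2 Hf t Ht; apply Hf; lra. Qed.

Lemma smooth_on_intro (l u : R) (f g : R -> R) :
  smooth_on l u g -> (forall t, l < t < u -> is_derive f t (g t)) ->
  smooth_on l u f.
Proof.
intros Hg Hfg.
apply smooth_on_coind with (P := fun h => h = f \/ smooth_on l u h).
2: left; reflexivity.
intros h [->|Hh].
- exists g; split; [right|]; assumption.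
- exists (Derive h); split; [right; apply smooth_on_Derive; assumption|].
  intros t Ht; apply (smooth_on_is_derive l u); assumption.
Qed.

(** The closure of the smooth functions under sums, products and inverses is
    stable under derivation by the usual rules, hence contains nothing else
    than smooth functions by [smooth_on_coind]. *)
Inductive smooth_expr (l u : R) : (R -> R) -> Prop :=
| smooth_expr_base f : smooth_on l u f -> smooth_expr l u f
| smooth_expr_plus f g : smooth_expr l u f -> smooth_expr l u g ->
    smooth_expr l u (fun t => f t + g t)
| smooth_expr_mult f g : smooth_expr l u f -> smooth_expr l u g ->
    smooth_expr l u (fun t => f t * g t)
| smooth_expr_inv f : smooth_expr l u f -> (forall t, l < t < u -> f t <> 0) ->
    smooth_expr l u (fun t => / f t).

Lemma smooth_on_const (l u k : R) : smooth_on l u (fun _ => k).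
Proof.
apply smooth_on_coind with (P := fun h => exists k, h = fun _ => k).
2: exists k; reflexivity.
intros f [k' ->]; exists (fun _ => 0); split; [exists 0; reflexivity|].
intros t _; apply @is_derive_const.
Qed.

Lemma smooth_on_expr (l u : R) (f : R -> R) :
  smooth_expr l u f -> smooth_on l u f.
Proof.
apply smooth_on_coind; clear f; intros f Hf.
induction Hf as [f Hf|f g Hf [f' [Pf Df]] Hg [g' [Pg Dg]]
                |f g Hf [f' [Pf Df]] Hg [g' [Pg Dg]]|f Hf [f' [Pf Df]] Hn].
- exists (Derive f); split; [apply smooth_expr_base, smooth_on_Derive; assumption|].
  intros t Ht; apply (smooth_on_is_derive l u); assumption.
- exists (fun t => f' t + g' t); split; [apply smooth_expr_plus; assumption|].
  intros t Ht; apply @is_derive_plus; [apply Df|apply Dg]; assumption.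
- exists (fun t => f' t * g t + f t * g' t); split.
  + apply smooth_expr_plus; apply smooth_expr_mult; assumption.
  + intros t Ht.
    apply (is_derive_mult f g t); [apply Df; assumption|apply Dg; assumption|].
    intros; apply Rmult_comm.
- exists (fun t => (-1) * f' t * (/ f t * / f t)); split.
  + apply smooth_expr_mult; [|apply smooth_expr_mult; apply smooth_expr_inv; assumption].
    apply smooth_expr_mult; [apply smooth_expr_base, smooth_on_const|assumption].
  + intros t Ht.
    replace (-1 * f' t * (/ f t * / f t)) with (- f' t / f t ^ 2)
      by (field; apply Hn, Ht).
    apply is_derive_inv; [apply Df, Ht|apply Hn, Ht].
Qed.

Lemma smooth_on_plus (l u : R) (f g : R -> R) :
  smooth_on l u f -> smooth_on l u g -> smooth_on l u (fun t => f t + g t).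
Proof. intros; apply smooth_on_expr, smooth_expr_plus; apply smooth_expr_base; assumption. Qed.

Lemma smooth_on_mult (l u : R) (f g : R -> R) :
  smooth_on l u f -> smooth_on l u g -> smooth_on l u (fun t => f t * g t).
Proof. intros; apply smooth_on_expr, smooth_expr_mult; apply smooth_expr_base; assumption. Qed.

Lemma smooth_on_inv (l u : R) (f : R -> R) :
  smooth_on l u f -> (forall t, l < t < u -> f t <> 0) ->
  smooth_on l u (fun t => / f t).
Proof.
intros; apply smooth_on_expr, smooth_expr_inv; [apply smooth_expr_base|]; assumption.
Qed.

Lemma smooth_on_div (l u : R) (f g : R -> R) :
  smooth_on l u f -> smooth_on l u g -> (forall t, l < t < u -> g t <> 0) ->
  smooth_on l u (fun t => f t / g t).
Proof.
intros; apply smooth_on_mult; [|apply smooth_on_inv]; assumption.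
Qed.

Lemma smooth_on_opp (l u : R) (f : R -> R) :
  smooth_on l u f -> smooth_on l u (fun t => - f t).
Proof.
intros Hf; apply smooth_on_intro with (g := fun t => (-1) * Derive f t).
- apply smooth_on_mult; [apply smooth_on_const|apply smooth_on_Derive, Hf].
- intros t Ht; replace (-1 * Derive f t) with (opp (Derive f t))
    by (unfold opp; simpl; ring).
  apply @is_derive_opp, (smooth_on_is_derive l u); assumption.
Qed.

Lemma smooth_on_minus (l u : R) (f g : R -> R) :
  smooth_on l u f -> smooth_on l u g -> smooth_on l u (fun t => f t - g t).
Proof.
intros; apply smooth_on_plus; [|apply smooth_on_opp]; assumption.
Qed.

Lemma smooth_on_id (l u : R) : smooth_on l u (fun t => t).
Proof.
apply smooth_on_intro with (g := fun _ => 1); [apply smooth_on_const|].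
intros; apply @is_derive_id.
Qed.

Lemma smooth_on_sin_cos (l u : R) : smooth_on l u sin /\ smooth_on l u cos.
Proof.
assert (H : forall f, (exists p q, f = fun t => p * sin t + q * cos t) ->
                      smooth_on l u f).
{ apply smooth_on_coind; intros f [p [q ->]].
  exists (fun t => (- q) * sin t + p * cos t); split.
  - exists (- q), p; reflexivity.
  - intros t _; auto_derive; [tauto|ring]. }
split; apply H.
- exists 1, 0; apply functional_extensionality; intro; ring.
- exists 0, 1; apply functional_extensionality; intro; ring.
Qed.

Lemma ex_RInt_smooth_on (l u a b : R) (f : R -> R) :
  smooth_on l u f -> l < a < u -> l < b < u -> ex_RInt f a b.
Proof.
intros Hf Ha Hb; apply @ex_RInt_continuous; intros z Hz.
apply (smooth_on_continuous l u); [assumption|].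
revert Hz; unfold Rmin, Rmax; destruct (Rle_dec a b); lra.
Qed.

Lemma is_derive_primitive (l u a t : R) (f : R -> R) :
  smooth_on l u f -> l < a < u -> l < t < u ->
  is_derive (fun z => RInt f a z) t (f t).
Proof.
intros Hf Ha Ht.
apply (is_derive_RInt f (fun z => RInt f a z) a t).
- apply (locally_between l u); [assumption|]; intros z Hz.
  apply @RInt_correct, (ex_RInt_smooth_on l u); assumption.
- apply (smooth_on_continuous l u); assumption.
Qed.

Lemma smooth_on_primitive (l u a : R) (f : R -> R) :
  smooth_on l u f -> l < a < u -> smooth_on l u (fun z => RInt f a z).
Proof.
intros Hf Ha; apply smooth_on_intro with (g := f); [assumption|].
intros t Ht; apply (is_derive_primitive l u); assumption.
Qed.

Lemma smooth_on_smooth_at (l u t : R) (f : R -> R) :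
  smooth_on l u f -> l < t < u -> smooth_at f t.
Proof. intros Hf Ht; apply (locally_between l u); assumption. Qed.

(** * Families that separate the parameter from time *)
(** Finite sums of products A(s) B(t), for |s| < r and l < t < u.  All the
    variations used below have this form.  Joint smoothness, primitives in t
    and derivation under the integral sign thus reduce to statements about
    functions of one variable. *)
Inductive separable (r l u : R) : (R -> R -> R) -> Prop :=
| sep_term A B : smooth_on (- r) r A -> smooth_on l u B ->
    separable r l u (fun s t => A s * B t)
| sep_plus f g : separable r l u f -> separable r l u g ->
    separable r l u (fun s t => f s t + g s t).

Lemma sep_ext (r l u : R) (f g : R -> R -> R) :
  (forall s t, f s t = g s t) -> separable r l u f -> separable r l u g.
Proof.
intros H Hf; replace g with f; [assumption|].
apply functional_extensionality; intro s; apply functional_extensionality.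
intro t; apply H.
Qed.

Lemma sep_mono (r r' l u : R) (f : R -> R -> R) :
  r' <= r -> separable r l u f -> separable r' l u f.
Proof.
intros Hr; induction 1; [|apply sep_plus; assumption].
apply sep_term; [|assumption]; apply (smooth_on_mono (- r) r); [lra|lra|assumption].
Qed.

Lemma sep_fst (r l u : R) (A : R -> R) :
  smooth_on (- r) r A -> separable r l u (fun s _ => A s).
Proof.
intros HA; apply (sep_ext r l u (fun s t => A s * 1)); [intros; ring|].
apply sep_term; [assumption|apply smooth_on_const].
Qed.

Lemma sep_snd (r l u : R) (B : R -> R) :
  smooth_on l u B -> separable r l u (fun _ t => B t).
Proof.
intros HB; apply (sep_ext r l u (fun s t => 1 * B t)); [intros; ring|].
apply (sep_term r l u (fun _ => 1)); [apply smooth_on_const|assumption].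
Qed.

Lemma sep_mult (r l u : R) (f g : R -> R -> R) :
  separable r l u f -> separable r l u g ->
  separable r l u (fun s t => f s t * g s t).
Proof.
intros Hf Hg; revert g Hg; induction Hf as [A B HA HB|f1 f2 H1 IH1 H2 IH2].
- intros g Hg; induction Hg as [C D HC HD|g1 g2 _ IH1 _ IH2].
  + apply (sep_ext r l u (fun s t => (A s * C s) * (B t * D t)));
      [intros; ring|].
    apply (sep_term r l u (fun s => A s * C s) (fun t => B t * D t));
      apply smooth_on_mult; assumption.
  + eapply sep_ext; [|apply sep_plus; [exact IH1|exact IH2]].
    intros; simpl; ring.
- intros g Hg; eapply sep_ext;
    [|apply sep_plus; [exact (IH1 g Hg)|exact (IH2 g Hg)]].
  intros; simpl; ring.
Qed.

Lemma sep_minus (r l u : R) (f g : R -> R -> R) :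
  separable r l u f -> separable r l u g ->
  separable r l u (fun s t => f s t - g s t).
Proof.
intros Hf Hg.
apply (sep_ext r l u (fun s t => f s t + (-1) * g s t)); [intros; ring|].
apply sep_plus; [assumption|].
apply (sep_mult r l u (fun _ _ => -1)); [|assumption].
apply sep_snd, smooth_on_const.
Qed.

Lemma sep_derive_fst (r l u : R) (f : R -> R -> R) :
  separable r l u f -> exists g, separable r l u g /\
    forall s t, - r < s < r -> is_derive (fun z => f z t) s (g s t).
Proof.
induction 1 as [A B HA HB|f1 f2 _ [g1 [S1 D1]] _ [g2 [S2 D2]]].
- exists (fun s t => Derive A s * B t); split.
  + apply sep_term; [apply smooth_on_Derive|]; assumption.
  + intros s t Hs.
    apply (is_derive_ext (fun z => scal (B t) (A z)));
      [intro; apply Rmult_comm|].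
    replace (Derive A s * B t) with (scal (B t) (Derive A s))
      by (apply Rmult_comm).
    apply @is_derive_scal, (smooth_on_is_derive (- r) r); assumption.
- exists (fun s t => g1 s t + g2 s t); split; [apply sep_plus; assumption|].
  intros s t Hs.
  apply (is_derive_plus (fun z => f1 z t) (fun z => f2 z t)); auto.
Qed.

Lemma sep_derive_snd (r l u : R) (f : R -> R -> R) :
  separable r l u f -> exists g, separable r l u g /\
    forall s t, l < t < u -> is_derive (f s) t (g s t).
Proof.
induction 1 as [A B HA HB|f1 f2 _ [g1 [S1 D1]] _ [g2 [S2 D2]]].
- exists (fun s t => A s * Derive B t); split.
  + apply sep_term; [|apply smooth_on_Derive]; assumption.
  + intros s t Ht.
    apply @is_derive_scal, (smooth_on_is_derive l u); assumption.
- exists (fun s t => g1 s t + g2 s t); split; [apply sep_plus; assumption|].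
  intros s t Ht; apply (is_derive_plus (f1 s) (f2 s)); auto.
Qed.

Lemma sep_smooth_snd (r l u : R) (f : R -> R -> R) (s : R) :
  separable r l u f -> smooth_on l u (f s).
Proof.
induction 1 as [A B HA HB|f1 f2 _ H1 _ H2].
- apply smooth_on_mult; [apply smooth_on_const|assumption].
- apply smooth_on_plus; assumption.
Qed.

Lemma sep_continuity_2d (r l u : R) (f : R -> R -> R) (s t : R) :
  separable r l u f -> - r < s < r -> l < t < u -> continuity_2d_pt f s t.
Proof.
intros Hf Hs Ht; induction Hf as [A B HA HB|f1 f2 _ H1 _ H2].
- apply continuity_2d_pt_mult.
  + apply (continuity_1d_2d_pt_comp A (fun u _ => u));
      [|apply continuity_2d_pt_id1].
    apply continuity_pt_filterlim, (smooth_on_continuous (- r) r); assumption.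
  + apply (continuity_1d_2d_pt_comp B (fun _ v => v));
      [|apply continuity_2d_pt_id2].
    apply continuity_pt_filterlim, (smooth_on_continuous l u); assumption.
- apply continuity_2d_pt_plus; assumption.
Qed.

Lemma locally_2d_box (r l u s t : R) (P : R -> R -> Prop) :
  - r < s < r -> l < t < u ->
  (forall z w, - r < z < r -> l < w < u -> P z w) -> locally_2d P s t.
Proof.
intros Hs Ht H.
destruct (locally_between (- r) r s _ Hs (fun z h => h)) as [d1 H1].
destruct (locally_between l u t _ Ht (fun z h => h)) as [d2 H2].
assert (Hd : 0 < Rmin d1 d2) by (apply Rmin_pos; [apply d1|apply d2]).
exists (mkposreal _ Hd); intros z w Hz Hw; simpl in Hz, Hw.
apply H; [apply H1|apply H2].
- apply Rlt_le_trans with (1 := Hz), Rmin_l.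
- apply Rlt_le_trans with (1 := Hw), Rmin_r.
Qed.

(** Both partial derivatives of a separable family are separable, so
    induction on the order of derivation applies. *)
Lemma sep_smooth2_at (r l u : R) (f : R -> R -> R) (s t : R) :
  separable r l u f -> - r < s < r -> l < t < u -> smooth2_at f s t.
Proof.
intros Hf Hs Ht; apply (locally_2d_box r l u); [assumption|assumption|].
clear s t Hs Ht; intros s t Hs Ht n; revert f Hf s t Hs Ht.
induction n as [|n IH]; intros f Hf s t Hs Ht.
- split; [|exact I]; apply (sep_continuity_2d r l u); assumption.
- destruct (sep_derive_fst r l u f Hf) as [g [Sg Dg]].
  destruct (sep_derive_snd r l u f Hf) as [h [Sh Dh]].
  split; [apply (sep_continuity_2d r l u); assumption|].
  split; [exists (g s t); apply Dg; assumption|].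
  split; [exists (h s t); apply Dh; assumption|].
  split.
  + apply ex_diff_n_ext_loc with (f := g); [|apply IH; assumption].
    apply (locally_2d_box r l u); [assumption|assumption|].
    intros; symmetry; apply is_derive_unique, Dg; assumption.
  + apply ex_diff_n_ext_loc with (f := h); [|apply IH; assumption].
    apply (locally_2d_box r l u); [assumption|assumption|].
    intros; symmetry; apply is_derive_unique, Dh; assumption.
Qed.

Lemma sep_primitive (r l u a : R) (f : R -> R -> R) :
  separable r l u f -> l < a < u -> exists F, separable r l u F /\
    (forall s t, l < t < u -> F s t = RInt (f s) a t) /\
    (forall s t, l < t < u -> is_derive (F s) t (f s t)).
Proof.
intros Hf Ha.
assert (H : exists F, separable r l u F /\
    forall s t, l < t < u -> F s t = RInt (f s) a t).
{ induction Hf as [A B HA HB|f1 f2 S1 [F1 [P1 E1]] S2 [F2 [P2 E2]]].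
  - exists (fun s t => A s * RInt B a t); split.
    + apply (sep_term r l u A (fun t => RInt B a t)); [assumption|].
      apply smooth_on_primitive; assumption.
    + intros s t Ht; symmetry; apply (RInt_scal B a t (A s)).
      apply (ex_RInt_smooth_on l u); assumption.
  - exists (fun s t => F1 s t + F2 s t); split; [apply sep_plus; assumption|].
    intros s t Ht; rewrite E1, E2 by assumption; symmetry.
    apply (RInt_plus (f1 s) (f2 s)); apply (ex_RInt_smooth_on l u);
      try assumption; eapply sep_smooth_snd; eassumption. }
destruct H as [F [SF EF]]; exists F; split; [assumption|]; split; [assumption|].
intros s t Ht.
apply is_derive_ext_loc with (f := fun z => RInt (f s) a z).
- apply (locally_between l u); [assumption|]; intros; symmetry; apply EF.
  assumption.
- apply (is_derive_primitive l u); try assumption.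
  eapply sep_smooth_snd; eassumption.
Qed.

Lemma sep_smooth_RInt (r l u a b : R) (f : R -> R -> R) :
  separable r l u f -> l < a < u -> l < b < u ->
  smooth_on (- r) r (fun s => RInt (f s) a b).
Proof.
intros Hf Ha Hb; destruct (sep_primitive r l u a f Hf Ha) as [F [SF [EF _]]].
replace (fun s => RInt (f s) a b) with (fun s => F s b)
  by (apply functional_extensionality; intro; apply EF, Hb).
clear EF; induction SF.
- apply (smooth_on_mult _ _ A (fun _ => B b)); [assumption|apply smooth_on_const].
- apply smooth_on_plus; assumption.
Qed.

(** Derivation under the integral sign; for one product A(s) B(t) this is
    only the linearity of the integral. *)
Lemma sep_is_derive_RInt (r l u a b s : R) (f : R -> R -> R) (h : R -> R) :
  separable r l u f -> l < a -> a < b -> b < u -> - r < s < r ->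
  (forall t, a <= t <= b -> is_derive (fun z => f z t) s (h t)) ->
  is_derive (fun z => RInt (f z) a b) s (RInt h a b).
Proof.
intros Hf Ha Hab Hb Hs Hh.
assert (Hm : forall t, Rmin a b < t < Rmax a b -> a <= t <= b).
{ intro t; rewrite Rmin_left, Rmax_right by lra; lra. }
assert (H : forall g, (forall t, a <= t <= b -> is_derive (fun z => f z t) s (g t))
  -> RInt g a b = RInt h a b).
{ intros g Hg; apply RInt_ext; intros t Ht.
  rewrite <- (is_derive_unique _ _ _ (Hg t (Hm t Ht))).
  apply is_derive_unique, Hh, Hm, Ht. }
assert (H' : exists g, smooth_on l u g /\
  (forall t, a <= t <= b -> is_derive (fun z => f z t) s (g t)) /\
  is_derive (fun z => RInt (f z) a b) s (RInt g a b)).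
{ clear h Hh H; induction Hf as [A B HA HB|f1 f2 S1 [g1 [Q1 [P1 E1]]] S2 [g2 [Q2 [P2 E2]]]].
  - exists (fun t => Derive A s * B t); split; [|split].
    + apply smooth_on_mult; [apply smooth_on_const|assumption].
    + intros t Ht.
      apply (is_derive_ext (fun z => scal (B t) (A z)));
        [intro; apply Rmult_comm|].
      replace (Derive A s * B t) with (scal (B t) (Derive A s))
        by (apply Rmult_comm).
      apply @is_derive_scal, (smooth_on_is_derive (- r) r); assumption.
    + assert (EB : forall k, RInt (fun t => k * B t) a b = RInt B a b * k).
      { intro k; rewrite Rmult_comm; apply (RInt_scal B a b k).
        apply (ex_RInt_smooth_on l u); [assumption|lra|lra]. }
      rewrite EB.
      apply (is_derive_ext (fun z => scal (RInt B a b) (A z))).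
      * intro; symmetry; apply EB.
      * apply (is_derive_scal A), (smooth_on_is_derive (- r) r); assumption.
  - exists (fun t => g1 t + g2 t); split; [apply smooth_on_plus; assumption|split].
    + intros t Ht.
      apply (is_derive_plus (fun z => f1 z t) (fun z => f2 z t)); auto.
    + replace (RInt (fun t => g1 t + g2 t) a b) with (RInt g1 a b + RInt g2 a b).
      2:{ symmetry; apply (RInt_plus g1 g2); apply (ex_RInt_smooth_on l u);
          try assumption; lra. }
      apply (is_derive_ext (fun z => RInt (f1 z) a b + RInt (f2 z) a b)).
      * intro z; symmetry; apply (RInt_plus (f1 z) (f2 z));
          apply (ex_RInt_smooth_on l u); try lra;
          eapply sep_smooth_snd; eassumption.
      * apply (is_derive_plus (fun z => RInt (f1 z) a b)); assumption. }
destruct H' as [g [_ [Hg D]]]; rewrite <- (H g Hg); exact D.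
Qed.

(** * Vectors and curves in Euclidean space *)
Definition vadd (p q : E3) : E3 :=
  (crd1 p + crd1 q, crd2 p + crd2 q, crd3 p + crd3 q).
Definition vsub (p q : E3) : E3 :=
  (crd1 p - crd1 q, crd2 p - crd2 q, crd3 p - crd3 q).
Definition vscal (k : R) (p : E3) : E3 := (k * crd1 p, k * crd2 p, k * crd3 p).
Definition cross (p q : E3) : E3 :=
  (crd2 p * crd3 q - crd3 p * crd2 q,
   crd3 p * crd1 q - crd1 p * crd3 q,
   crd1 p * crd2 q - crd2 p * crd1 q).
Definition det3 (p q r : E3) : R := dot p (cross q r).

Ltac vunfold :=
  cbv [vadd vsub vscal cross det3 dot crd1 crd2 crd3 fst snd].

Ltac vring := intros; vunfold; ring.

Lemma E3_eq (p q : E3) :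
  crd1 p = crd1 q -> crd2 p = crd2 q -> crd3 p = crd3 q -> p = q.
Proof. destruct p as [[? ?] ?], q as [[? ?] ?]; cbn; intros -> -> ->; reflexivity. Qed.

Ltac veq := intros; apply E3_eq; vring.

Lemma dot_self_eq0 (p : E3) : dot p p = 0 -> p = (0, 0, 0).
Proof.
unfold dot; intro H; apply E3_eq; apply Rsqr_0_uniq; unfold Rsqr; nra.
Qed.

Lemma dot_self_ge0 (p : E3) : 0 <= dot p p.
Proof. unfold dot; nra. Qed.

(** Cauchy-Schwarz against a unit vector, from Lagrange's identity. *)
Lemma dot_le_norm (p q : E3) :
  dot p p = 1 -> dot p q <= norm (q : R * R * R).
Proof.
intros Hp; rewrite norm_E3.
apply Rle_trans with (1 := Rle_abs _).
rewrite <- sqrt_Rsqr_abs; apply sqrt_le_1_alt.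
assert (H : dot p p * dot q q - Rsqr (dot p q) = dot (cross p q) (cross p q)).
{ unfold Rsqr; vring. }
rewrite Hp in H; assert (H' := dot_self_ge0 (cross p q)); lra.
Qed.

Lemma norm_eq1_dot (p : E3) : norm (p : R * R * R) = 1 <-> dot p p = 1.
Proof.
rewrite norm_E3; split; intro H; [|rewrite H; apply sqrt_1].
rewrite <- (sqrt_sqrt (dot p p)) by apply dot_self_ge0; rewrite H; ring.
Qed.

Definition cramer (m1 m2 m3 r : E3) : E3 :=
  (det3 r m2 m3 / det3 m1 m2 m3,
   det3 m1 r m3 / det3 m1 m2 m3,
   det3 m1 m2 r / det3 m1 m2 m3).

Lemma cramer_eq (m1 m2 m3 r : E3) : det3 m1 m2 m3 <> 0 ->
  let x := cramer m1 m2 m3 r in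
  vadd (vscal (crd1 x) m1) (vadd (vscal (crd2 x) m2) (vscal (crd3 x) m3)) = r.
Proof.
intros H x; subst x; unfold cramer; cbn [crd1 crd2 crd3 fst snd].
apply E3_eq; revert H; vunfold; intro; field; assumption.
Qed.

Definition smooth3 (l u : R) (g : R -> E3) : Prop :=
  smooth_on l u (fun t => crd1 (g t)) /\ smooth_on l u (fun t => crd2 (g t)) /\
  smooth_on l u (fun t => crd3 (g t)).

Definition separable3 (r l u : R) (G : R -> R -> E3) : Prop :=
  separable r l u (fun s t => crd1 (G s t)) /\
  separable r l u (fun s t => crd2 (G s t)) /\
  separable r l u (fun s t => crd3 (G s t)).

Definition is_derive3 (g : R -> E3) (t : R) (g' : E3) : Prop :=
  is_derive (fun z => crd1 (g z)) t (crd1 g') /\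
  is_derive (fun z => crd2 (g z)) t (crd2 g') /\
  is_derive (fun z => crd3 (g z)) t (crd3 g').

Definition vRInt (g : R -> E3) (a b : R) : E3 :=
  (RInt (fun t => crd1 (g t)) a b, RInt (fun t => crd2 (g t)) a b,
   RInt (fun t => crd3 (g t)) a b).

Lemma smooth3_vadd (l u : R) (f g : R -> E3) :
  smooth3 l u f -> smooth3 l u g -> smooth3 l u (fun t => vadd (f t) (g t)).
Proof.
intros (?&?&?) (?&?&?).
repeat split; apply smooth_on_plus; assumption.
Qed.

Lemma smooth3_vsub (l u : R) (f g : R -> E3) :
  smooth3 l u f -> smooth3 l u g -> smooth3 l u (fun t => vsub (f t) (g t)).
Proof.
intros (?&?&?) (?&?&?).
repeat split; apply smooth_on_minus; assumption.
Qed.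

Lemma smooth3_vscal (l u : R) (k : R -> R) (g : R -> E3) :
  smooth_on l u k -> smooth3 l u g -> smooth3 l u (fun t => vscal (k t) (g t)).
Proof.
intros ? (?&?&?).
repeat split; apply smooth_on_mult; assumption.
Qed.

Lemma smooth3_cross (l u : R) (f g : R -> E3) :
  smooth3 l u f -> smooth3 l u g -> smooth3 l u (fun t => cross (f t) (g t)).
Proof.
intros (?&?&?) (?&?&?).
repeat split; apply smooth_on_minus; apply smooth_on_mult; assumption.
Qed.

Lemma smooth_on_dot (l u : R) (f g : R -> E3) :
  smooth3 l u f -> smooth3 l u g -> smooth_on l u (fun t => dot (f t) (g t)).
Proof.
intros (?&?&?) (?&?&?).
apply smooth_on_plus; [apply smooth_on_plus|]; apply smooth_on_mult; assumption.
Qed.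

Lemma smooth3_const (l u : R) (p : E3) : smooth3 l u (fun _ => p).
Proof. repeat split; apply smooth_on_const. Qed.

Lemma sep3_vadd (r l u : R) (f g : R -> R -> E3) :
  separable3 r l u f -> separable3 r l u g ->
  separable3 r l u (fun s t => vadd (f s t) (g s t)).
Proof.
intros (?&?&?) (?&?&?).
repeat split; apply sep_plus; assumption.
Qed.

Lemma sep3_vscal (r l u : R) (k : R -> R -> R) (g : R -> R -> E3) :
  separable r l u k -> separable3 r l u g ->
  separable3 r l u (fun s t => vscal (k s t) (g s t)).
Proof.
intros ? (?&?&?).
repeat split; apply sep_mult; assumption.
Qed.

Lemma sep_dot (r l u : R) (f g : R -> R -> E3) :
  separable3 r l u f -> separable3 r l u g ->
  separable r l u (fun s t => dot (f s t) (g s t)).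
Proof.
intros (?&?&?) (?&?&?).
apply sep_plus; [apply sep_plus|]; apply sep_mult; assumption.
Qed.

Lemma sep3_snd (r l u : R) (g : R -> E3) :
  smooth3 l u g -> separable3 r l u (fun _ t => g t).
Proof.
intros (?&?&?).
split; [|split]; apply (sep_snd r l u (fun t => _ (g t))); assumption.
Qed.

Lemma sep3_fst (r l u : R) (g : R -> E3) :
  smooth3 (- r) r g -> separable3 r l u (fun s _ => g s).
Proof.
intros (?&?&?).
split; [|split]; apply (sep_fst r l u (fun t => _ (g t))); assumption.
Qed.

Lemma sep3_smooth_snd (r l u : R) (f : R -> R -> E3) (s : R) :
  separable3 r l u f -> smooth3 l u (f s).
Proof.
intros (H1&H2&H3); split; [|split];
  [exact (sep_smooth_snd r l u _ s H1)|exact (sep_smooth_snd r l u _ s H2)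
  |exact (sep_smooth_snd r l u _ s H3)].
Qed.

Lemma sep3_mono (r r' l u : R) (f : R -> R -> E3) :
  r' <= r -> separable3 r l u f -> separable3 r' l u f.
Proof.
intros Hr (H1&H2&H3); split; [|split]; apply (sep_mono r); assumption.
Qed.

Lemma is_derive3_dot (f g : R -> E3) (t : R) (f' g' : E3) :
  is_derive3 f t f' -> is_derive3 g t g' ->
  is_derive (fun z => dot (f z) (g z)) t (dot f' (g t) + dot (f t) g').
Proof.
intros (F1&F2&F3) (G1&G2&G3).
replace (dot f' (g t) + dot (f t) g') with
  ((crd1 f' * crd1 (g t) + crd1 (f t) * crd1 g')
   + (crd2 f' * crd2 (g t) + crd2 (f t) * crd2 g')
   + (crd3 f' * crd3 (g t) + crd3 (f t) * crd3 g')) by (unfold dot; ring).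
assert (DM : forall F G F' G', is_derive F t F' -> is_derive G t G' ->
  is_derive (fun z => F z * G z) t (F' * G t + F t * G')).
{ intros; apply (is_derive_mult F G); try assumption; intros; apply Rmult_comm. }
apply (is_derive_plus
  (fun z => crd1 (f z) * crd1 (g z) + crd2 (f z) * crd2 (g z))
  (fun z => crd3 (f z) * crd3 (g z)));
[apply (is_derive_plus
  (fun z => crd1 (f z) * crd1 (g z)) (fun z => crd2 (f z) * crd2 (g z)))|];
[apply (DM (fun z => crd1 (f z)) (fun z => crd1 (g z)))
|apply (DM (fun z => crd2 (f z)) (fun z => crd2 (g z)))
|apply (DM (fun z => crd3 (f z)) (fun z => crd3 (g z)))]; assumption.
Qed.

Lemma is_derive3_const (p : E3) (t : R) : is_derive3 (fun _ => p) t (0, 0, 0).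
Proof. split; [|split]; apply @is_derive_const. Qed.

Lemma is_derive3_vadd (f g : R -> E3) (t : R) (f' g' : E3) :
  is_derive3 f t f' -> is_derive3 g t g' ->
  is_derive3 (fun z => vadd (f z) (g z)) t (vadd f' g').
Proof.
intros (F1&F2&F3) (G1&G2&G3); split; [|split].
- apply (is_derive_plus (fun z => crd1 (f z)) (fun z => crd1 (g z))); assumption.
- apply (is_derive_plus (fun z => crd2 (f z)) (fun z => crd2 (g z))); assumption.
- apply (is_derive_plus (fun z => crd3 (f z)) (fun z => crd3 (g z))); assumption.
Qed.

Lemma is_derive3_vsub (f g : R -> E3) (t : R) (f' g' : E3) :
  is_derive3 f t f' -> is_derive3 g t g' ->
  is_derive3 (fun z => vsub (f z) (g z)) t (vsub f' g').
Proof.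
intros (F1&F2&F3) (G1&G2&G3); split; [|split].
- apply (is_derive_minus (fun z => crd1 (f z)) (fun z => crd1 (g z))); assumption.
- apply (is_derive_minus (fun z => crd2 (f z)) (fun z => crd2 (g z))); assumption.
- apply (is_derive_minus (fun z => crd3 (f z)) (fun z => crd3 (g z))); assumption.
Qed.

Lemma is_derive3_vscal (k : R -> R) (g : R -> E3) (t k' : R) (g' : E3) :
  is_derive k t k' -> is_derive3 g t g' ->
  is_derive3 (fun z => vscal (k z) (g z)) t
    (vadd (vscal k' (g t)) (vscal (k t) g')).
Proof.
intros K (G1&G2&G3); split; [|split]; cbn [vscal vadd crd1 crd2 crd3 fst snd];
[apply (is_derive_mult k (fun z => crd1 (g z)))
|apply (is_derive_mult k (fun z => crd2 (g z)))
|apply (is_derive_mult k (fun z => crd3 (g z)))];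
try assumption; intros; apply Rmult_comm.
Qed.

Lemma is_derive3_cross (f g : R -> E3) (t : R) (f' g' : E3) :
  is_derive3 f t f' -> is_derive3 g t g' ->
  is_derive3 (fun z => cross (f z) (g z)) t
    (vadd (cross f' (g t)) (cross (f t) g')).
Proof.
assert (H : forall F G H K F' G' H' K', is_derive F t F' -> is_derive G t G' ->
  is_derive H t H' -> is_derive K t K' ->
  is_derive (fun z => F z * G z - H z * K z) t
    (F' * G t - H' * K t + (F t * G' - H t * K'))).
{ intros F G H K F' G' H' K' DF DG DH DK.
  replace (F' * G t - H' * K t + (F t * G' - H t * K')) with
   ((F' * G t + F t * G') - (H' * K t + H t * K')) by ring.
  apply (is_derive_minus (fun z => F z * G z) (fun z => H z * K z));
  [apply (is_derive_mult F G)|apply (is_derive_mult H K)]; try assumption;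
  intros; apply Rmult_comm. }
intros (F1&F2&F3) (G1&G2&G3); split; [|split];
  cbn [cross vadd crd1 crd2 crd3 fst snd].
- apply (H (fun z => crd2 (f z)) (fun z => crd3 (g z))); assumption.
- apply (H (fun z => crd3 (f z)) (fun z => crd1 (g z))); assumption.
- apply (H (fun z => crd1 (f z)) (fun z => crd2 (g z))); assumption.
Qed.

Lemma is_derive3_det3 (f g h : R -> E3) (t : R) (f' g' h' : E3) :
  is_derive3 f t f' -> is_derive3 g t g' -> is_derive3 h t h' ->
  is_derive (fun z => det3 (f z) (g z) (h z)) t
    (det3 f' (g t) (h t) + det3 (f t) g' (h t) + det3 (f t) (g t) h').
Proof.
intros F G H.
replace (det3 f' (g t) (h t) + det3 (f t) g' (h t) + det3 (f t) (g t) h')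
 with (dot f' (cross (g t) (h t))
       + dot (f t) (vadd (cross g' (h t)) (cross (g t) h')))
 by (generalize (f t) (g t) (h t); vring).
apply (is_derive3_dot f (fun z => cross (g z) (h z))); [assumption|].
apply is_derive3_cross; assumption.
Qed.

Lemma is_derive3_unique (g : R -> E3) (t : R) (p q : E3) :
  is_derive3 g t p -> is_derive3 g t q -> p = q.
Proof.
intros (A1&A2&A3) (B1&B2&B3); apply E3_eq.
- rewrite <- (is_derive_unique _ _ _ A1); apply is_derive_unique, B1.
- rewrite <- (is_derive_unique _ _ _ A2); apply is_derive_unique, B2.
- rewrite <- (is_derive_unique _ _ _ A3); apply is_derive_unique, B3.
Qed.

(** [jet 1] is convertible to [velocity], so that lemmas about derivatives of
    any order apply to velocities. *)
Definition jet (n : nat) (g : R -> E3) (t : R) : E3 :=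
  (Derive_n (fun z => crd1 (g z)) n t, Derive_n (fun z => crd2 (g z)) n t,
   Derive_n (fun z => crd3 (g z)) n t).

Lemma smooth_on_Derive_n (l u : R) (f : R -> R) (n : nat) :
  smooth_on l u f -> smooth_on l u (Derive_n f n).
Proof.
intros Hf; induction n as [|n IH]; [exact Hf|].
exact (smooth_on_Derive l u _ IH).
Qed.

Lemma smooth3_jet (l u : R) (g : R -> E3) (n : nat) :
  smooth3 l u g -> smooth3 l u (jet n g).
Proof.
intros (G1&G2&G3); split; [|split]; apply smooth_on_Derive_n; assumption.
Qed.

Lemma is_derive3_jet (l u : R) (g : R -> E3) (n : nat) (t : R) :
  smooth3 l u g -> l < t < u -> is_derive3 (jet n g) t (jet (S n) g t).
Proof.
intros (G1&G2&G3) Ht; split; [|split];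
  apply (smooth_on_is_derive l u); try assumption;
  apply smooth_on_Derive_n; assumption.
Qed.

Lemma is_derive3_velocity (l u : R) (g : R -> E3) (t : R) :
  smooth3 l u g -> l < t < u -> is_derive3 g t (velocity g t).
Proof. apply (is_derive3_jet l u g 0). Qed.

Lemma velocity_unique (g : R -> E3) (t : R) (p : E3) :
  is_derive3 g t p -> velocity g t = p.
Proof. intros (A&B&C); apply E3_eq; apply is_derive_unique; assumption. Qed.

Lemma smooth3_smooth_curve (l u a b : R) (g : R -> E3) :
  smooth3 l u g -> l < a -> b < u -> smooth_curve (segment a b) g.
Proof.
intros (G1&G2&G3) Ha Hb t Ht; unfold segment in Ht.
split; [|split]; apply (smooth_on_smooth_at l u); try assumption; lra.
Qed.

(** * Swinging the frame and steering the back wheel *)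
(** The rotation by the angle s of the unit vector v about the axis v - B,
    where B is the component of v orthogonal to the axis.  For z orthogonal to
    v, the axis is chosen so that the initial velocity is 2 z / (1 + |z|^2);
    with this rational scaling of z the vector B needs no square root.  The
    result is affine in cos s and sin s, hence separable when v and z depend
    on time, and equal to v where z vanishes. *)
Definition swing (s : R) (v z : E3) : E3 :=
  let n := dot z z in
  let k := / (1 + n) in
  vadd v
    (vadd (vscal (cos s - 1)
             (vadd (vscal (4 * n * (k * k)) v)
                   (vscal (2 * (1 - n) * (k * k)) (cross v z))))
          (vscal (sin s) (vscal (2 * k) z))).

Lemma swing_unit (s : R) (v z : E3) :
  dot v v = 1 -> dot v z = 0 -> dot (swing s v z) (swing s v z) = 1.
Proof.
intros Hv Hz; unfold swing.
assert (Hn := dot_self_ge0 z).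
assert (E : forall al be ga, let w := vadd v (vadd
     (vscal (cos s - 1) (vadd (vscal al v) (vscal be (cross v z))))
     (vscal (sin s) (vscal ga z))) in
   dot w w = (1 + (cos s - 1) * al)^2 * dot v v
     + 2 * (1 + (cos s - 1) * al) * (sin s * ga) * dot v z
     + (sin s * ga)^2 * dot z z
     + ((cos s - 1) * be)^2 * (dot v v * dot z z - (dot v z)^2)).
{ cbv zeta; vring. }
cbv zeta in E |- *; rewrite E, Hv, Hz; clear E.
set (n := dot z z) in *; clearbody n.
assert (Hcs := sin2_cos2 s); unfold Rsqr in Hcs.
assert (Hs : sin s ^ 2 = 1 - cos s ^ 2) by lra.
rewrite !Rpow_mult_distr, Hs; field; lra.
Qed.

Lemma swing_0 (v z : E3) : swing 0 v z = v.
Proof.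
unfold swing; rewrite cos_0, sin_0; cbv zeta; generalize (/ (1 + dot z z)).
veq.
Qed.

Lemma swing_fix (s : R) (v : E3) : swing s v (0, 0, 0) = v.
Proof. unfold swing; cbv zeta; generalize (/ (1 + dot (0, 0, 0) (0, 0, 0))); veq. Qed.

Lemma smooth_on_swing_factor (l u : R) (z : R -> E3) :
  smooth3 l u z -> smooth_on l u (fun t => / (1 + dot (z t) (z t))).
Proof.
intros Hz; apply smooth_on_inv.
- apply smooth_on_plus; [apply smooth_on_const|apply smooth_on_dot; assumption].
- intros t _; assert (H := dot_self_ge0 (z t)); lra.
Qed.

Lemma sep3_swing (r l u : R) (v z : R -> E3) :
  smooth3 l u v -> smooth3 l u z ->
  separable3 r l u (fun s t => swing s (v t) (z t)).
Proof.
intros Hv Hz.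
assert (Hk := smooth_on_swing_factor l u z Hz).
assert (Hn := smooth_on_dot l u z z Hz Hz).
unfold swing; apply sep3_vadd; [apply sep3_snd; assumption|].
apply sep3_vadd; apply sep3_vscal.
- apply (sep_fst r l u (fun s => cos s - 1)), smooth_on_minus;
    [apply smooth_on_sin_cos|apply smooth_on_const].
- apply (sep3_snd r l u (fun t => vadd _ _)).
  apply smooth3_vadd; apply smooth3_vscal; try assumption.
  + apply smooth_on_mult; apply smooth_on_mult; try assumption.
    apply smooth_on_const.
  + apply smooth_on_mult; apply smooth_on_mult; try assumption.
    * apply smooth_on_const.
    * apply smooth_on_minus; [apply smooth_on_const|assumption].
  + apply smooth3_cross; assumption.
- apply (sep_fst r l u sin), smooth_on_sin_cos.
- apply (sep3_snd r l u (fun t => vscal _ _)), smooth3_vscal; [|assumption].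
  apply smooth_on_mult; [apply smooth_on_const|assumption].
Qed.

Lemma is_derive3_swing (v z : E3) :
  is_derive3 (fun s => swing s v z) 0 (vscal (2 * / (1 + dot z z)) z).
Proof.
assert (H : forall x y w, is_derive
  (fun s => x + ((cos s - 1) * y + sin s * w)) 0 w).
{ intros x y w; auto_derive; [tauto|]; rewrite sin_0, cos_0; ring. }
split; [|split]; apply H.
Qed.

(** The integral of i(v) w, for a coordinate function i: the effect on the
    displacement of the back wheel of adding i(v) to the rate c when the frame
    is w. *)
Definition moment (v w : R -> E3) (a b : R) (i : E3 -> R) : E3 :=
  vRInt (fun t => vscal (i (v t)) (w t)) a b.

Lemma RInt_comb (l u a b x0 x1 x2 x3 : R) (f0 f1 f2 f3 : R -> R) :
  l < a < u -> l < b < u ->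
  smooth_on l u f0 -> smooth_on l u f1 -> smooth_on l u f2 -> smooth_on l u f3 ->
  RInt (fun t => x0 * f0 t + (x1 * f1 t + (x2 * f2 t + x3 * f3 t))) a b =
  x0 * RInt f0 a b
  + (x1 * RInt f1 a b + (x2 * RInt f2 a b + x3 * RInt f3 a b)).
Proof.
intros Ha Hb H0 H1 H2 H3; apply is_RInt_unique.
assert (HR : forall x f, smooth_on l u f ->
  is_RInt (fun t => x * f t) a b (x * RInt f a b)).
{ intros x f Hf; apply (is_RInt_scal f a b x).
  apply (RInt_correct (V := R_CompleteNormedModule)), (ex_RInt_smooth_on l u);
    assumption. }
apply (is_RInt_plus (V := R_NormedModule) (fun t => x0 * f0 t)); [auto|].
apply (is_RInt_plus (V := R_NormedModule) (fun t => x1 * f1 t)); [auto|].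
apply (is_RInt_plus (V := R_NormedModule) (fun t => x2 * f2 t)); auto.
Qed.

Lemma vRInt_comb (l u a b : R) (c : R -> R) (v w : R -> E3) (m : E3) :
  l < a < u -> l < b < u ->
  smooth_on l u c -> smooth3 l u v -> smooth3 l u w ->
  vRInt (fun t => vscal (c t + dot m (v t)) (w t)) a b =
  vadd (vRInt (fun t => vscal (c t) (w t)) a b)
   (vadd (vscal (crd1 m) (moment v w a b crd1))
     (vadd (vscal (crd2 m) (moment v w a b crd2))
           (vscal (crd3 m) (moment v w a b crd3)))).
Proof.
intros Ha Hb Hc (V1&V2&V3) (W1&W2&W3).
assert (H : forall f, smooth_on l u f ->
  RInt (fun t => (c t + dot m (v t)) * f t) a b =
  RInt (fun t => c t * f t) a b
  + (crd1 m * RInt (fun t => crd1 (v t) * f t) a b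
  + (crd2 m * RInt (fun t => crd2 (v t) * f t) a b
  + crd3 m * RInt (fun t => crd3 (v t) * f t) a b))).
{ intros f Hf; rewrite <- (Rmult_1_l (RInt (fun t => c t * f t) a b)).
  rewrite <- (RInt_comb l u) by (try apply smooth_on_mult; assumption).
  apply RInt_ext; intros t _; unfold dot.
  match goal with |- ?x = ?y => change (@eq R x y) end; ring. }
apply E3_eq; apply H; assumption.
Qed.

Lemma moment_smooth (r l u a b : R) (v : R -> E3) (V : R -> R -> E3)
    (i : E3 -> R) :
  l < a < u -> l < b < u -> separable3 r l u V ->
  smooth_on l u (fun t => i (v t)) ->
  smooth3 (- r) r (fun s => moment v (V s) a b i).
Proof.
intros Ha Hb (V1&V2&V3) Hv; split; [|split]; unfold moment, vRInt;
cbn [crd1 crd2 crd3 fst snd vscal].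
- apply (sep_smooth_RInt r l u a b (fun s t => i (v t) * crd1 (V s t)));
  try assumption; apply sep_mult; [apply (sep_snd r l u (fun t => i (v t)))|];
  assumption.
- apply (sep_smooth_RInt r l u a b (fun s t => i (v t) * crd2 (V s t)));
  try assumption; apply sep_mult; [apply (sep_snd r l u (fun t => i (v t)))|];
  assumption.
- apply (sep_smooth_RInt r l u a b (fun s t => i (v t) * crd3 (V s t)));
  try assumption; apply sep_mult; [apply (sep_snd r l u (fun t => i (v t)))|];
  assumption.
Qed.

Lemma vRInt_smooth (r l u a b : R) (V : R -> R -> E3) :
  l < a < u -> l < b < u -> separable3 r l u V ->
  smooth3 (- r) r (fun s => vRInt (V s) a b).
Proof.
intros Ha Hb (V1&V2&V3); split; [|split].
- apply (sep_smooth_RInt r l u a b (fun s t => crd1 (V s t))); assumption.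
- apply (sep_smooth_RInt r l u a b (fun s t => crd2 (V s t))); assumption.
- apply (sep_smooth_RInt r l u a b (fun s t => crd3 (V s t))); assumption.
Qed.

Lemma smooth3_mono (l u l' u' : R) (g : R -> E3) :
  l <= l' -> u' <= u -> smooth3 l u g -> smooth3 l' u' g.
Proof.
intros Hl Hu (G1&G2&G3); split; [|split]; apply (smooth_on_mono l u); assumption.
Qed.

Lemma smooth3_cramer (l u : R) (m1 m2 m3 g : R -> E3) :
  smooth3 l u m1 -> smooth3 l u m2 -> smooth3 l u m3 -> smooth3 l u g ->
  (forall t, l < t < u -> det3 (m1 t) (m2 t) (m3 t) <> 0) ->
  smooth3 l u (fun t => cramer (m1 t) (m2 t) (m3 t) (g t)).
Proof.
intros H1 H2 H3 Hg Hd.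
split; [|split]; (apply smooth_on_div; [| |assumption]);
  apply smooth_on_dot; try assumption; apply smooth3_cross; assumption.
Qed.

(** The displacement of the back wheel is affine in the rate c, so prescribing
    it after a variation is a linear 3 x 3 system for the coefficients M(s) of
    the correction M(s) . v.  Its matrix at s = 0 is the Gram matrix of the
    coordinates of v; Cramer's formulas give a smooth solution as long as the
    determinant does not vanish. *)
Lemma steering (r l u a b : R) (c : R -> R -> R) (V : R -> R -> E3) :
  0 < r -> l < a < u -> l < b < u ->
  separable r l u c -> separable3 r l u V ->
  det3 (moment (V 0) (V 0) a b crd1) (moment (V 0) (V 0) a b crd2)
       (moment (V 0) (V 0) a b crd3) <> 0 ->
  exists (e : R) (M : R -> E3), 0 < e <= r /\ smooth3 (- e) e M /\
    M 0 = (0, 0, 0) /\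
    forall s, - e < s < e ->
    vRInt (fun t => vscal (c s t + dot (M s) (V 0 t)) (V s t)) a b =
    vRInt (fun t => vscal (c 0 t) (V 0 t)) a b.
Proof.
intros Hr Ha Hb Hc HV Hdet.
set (v := V 0) in *.
assert (Hv : smooth3 l u v) by (apply (sep3_smooth_snd r); assumption).
set (m i s := moment v (V s) a b i).
assert (Hm : smooth3 (- r) r (m crd1) /\ smooth3 (- r) r (m crd2) /\
             smooth3 (- r) r (m crd3)).
{ destruct Hv as (V1&V2&V3).
  split; [|split]; apply (moment_smooth r l u); assumption. }
destruct Hm as (M1&M2&M3).
set (det s := det3 (m crd1 s) (m crd2 s) (m crd3 s)).
assert (Hds : smooth_on (- r) r det)
  by (apply smooth_on_dot; [|apply smooth3_cross]; assumption).
assert (HE : exists e, 0 < e <= r /\ forall s, - e < s < e -> det s <> 0).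
{ assert (C := smooth_on_continuous (- r) r det 0 Hds ltac:(lra)).
  assert (Hpos : 0 < Rabs (det 0)) by (apply Rabs_pos_lt; exact Hdet).
  destruct (C (ball (det 0) (mkposreal _ Hpos)) (locally_ball _ _)) as [d Hd].
  exists (Rmin d r); split.
  - split; [apply Rmin_pos; [apply d|assumption]|apply Rmin_r].
  - intros s Hs E0.
    assert (A := Rmin_l d r).
    assert (Hb' : ball 0 d s).
    { change (Rabs (s - 0) < d); apply Rabs_def1; lra. }
    assert (Q := Hd s Hb'); change (Rabs (det s - det 0) < Rabs (det 0)) in Q.
    rewrite E0, Rminus_0_l, Rabs_Ropp in Q; lra. }
destruct HE as (e&He&Hne).
set (F s := vRInt (fun t => vscal (c s t) (V s t)) a b).
assert (HF : smooth3 (- r) r F).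
{ apply (vRInt_smooth r l u a b (fun s t => vscal (c s t) (V s t)));
    try assumption; apply sep3_vscal; assumption. }
exists e, (fun s => cramer (m crd1 s) (m crd2 s) (m crd3 s) (vsub (F 0) (F s))).
split; [assumption|split; [|split]].
- apply smooth3_cramer; [| | | |exact Hne];
    apply (smooth3_mono (- r) r); try lra; try assumption.
  apply smooth3_vsub; [apply smooth3_const|assumption].
- unfold cramer; generalize (m crd1 0) (m crd2 0) (m crd3 0) (F 0).
  intros p q w z; apply E3_eq; cbn [crd1 crd2 crd3 fst snd];
  (match goal with |- ?x / _ = 0 => replace x with 0 by vring end);
  apply Rmult_0_l.
- intros s Hs.
  rewrite (vRInt_comb l u a b (c s) v (V s));
    [|assumption|assumption|eapply sep_smooth_snd; eassumption|assumption
     |apply (sep3_smooth_snd r); assumption].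
  assert (EC := cramer_eq (m crd1 s) (m crd2 s) (m crd3 s) (vsub (F 0) (F s))
    (Hne s Hs)); cbv zeta in EC.
  match goal with |- vadd _ ?X = _ => replace X with (vsub (F 0) (F s)) end.
  change (vadd (F s) (vsub (F 0) (F s)) = F 0).
  generalize (F s) (F 0); veq.
Qed.

(** * The first variation of length *)
Lemma sep3_primitive (r l u a : R) (F : R -> R -> E3) :
  separable3 r l u F -> l < a < u -> exists P, separable3 r l u P /\
    (forall s t, l < t < u -> P s t = vRInt (F s) a t) /\
    (forall s t, l < t < u -> is_derive3 (P s) t (F s t)).
Proof.
intros (F1&F2&F3) Ha.
destruct (sep_primitive r l u a _ F1 Ha) as (P1&S1&E1&D1).
destruct (sep_primitive r l u a _ F2 Ha) as (P2&S2&E2&D2).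
destruct (sep_primitive r l u a _ F3 Ha) as (P3&S3&E3&D3).
exists (fun s t => (P1 s t, P2 s t, P3 s t)).
split; [split; [|split]; assumption|split].
- intros s t Ht; rewrite E1, E2, E3 by assumption; reflexivity.
- intros s t Ht; split; [|split];
  [exact (D1 s t Ht)|exact (D2 s t Ht)|exact (D3 s t Ht)].
Qed.

Lemma sep3_smooth_family_at (r l u : R) (F : R -> R -> E3) (s t : R) :
  separable3 r l u F -> - r < s < r -> l < t < u -> smooth_family_at F s t.
Proof.
intros (F1&F2&F3) Hs Ht.
split; [|split]; apply (sep_smooth2_at r l u); assumption.
Qed.

(** Fermat's rule at an interior minimum. *)
Lemma is_derive_min_zero (f : R -> R) (e d : R) :
  0 < e -> (forall s, - e < s < e -> f 0 <= f s) -> is_derive f 0 d -> d = 0.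
Proof.
intros He Hmin Hd.
assert (D : derivable_pt_lim f 0 d) by (apply is_derive_Reals; exact Hd).
rewrite <- (derive_pt_eq_0 f 0 d (exist _ d D) D).
apply (deriv_minimum f (- e) e 0 (exist _ d D)); [lra|lra|].
intros s H1 H2; apply Hmin; lra.
Qed.

Lemma is_derive3_const_eq (g : R -> E3) (a b : R) :
  a < b -> (forall t, a <= t <= b -> is_derive3 g t (0, 0, 0)) -> g a = g b.
Proof.
intros Hab H; apply E3_eq.
- apply (eq_is_derive (fun t => crd1 (g t)) a b); [|assumption].
  intros t Ht; apply H; assumption.
- apply (eq_is_derive (fun t => crd2 (g t)) a b); [|assumption].
  intros t Ht; apply H; assumption.
- apply (eq_is_derive (fun t => crd3 (g t)) a b); [|assumption].
  intros t Ht; apply H; assumption.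
Qed.

Lemma is_derive3_ext_loc (l u : R) (f g : R -> E3) (t : R) (p : E3) :
  l < t < u -> (forall z, l < z < u -> f z = g z) ->
  is_derive3 f t p -> is_derive3 g t p.
Proof.
intros Ht H (D1&D2&D3); split; [|split];
[apply is_derive_ext_loc with (2 := D1)
|apply is_derive_ext_loc with (2 := D2)
|apply is_derive_ext_loc with (2 := D3)];
apply (locally_between l u); try assumption; intros z Hz; rewrite H;
auto.
Qed.

Lemma ex_RInt_speed (l u a b : R) (g : R -> E3) :
  l < a < u -> l < b < u -> smooth3 l u g -> ex_RInt (speed g) a b.
Proof.
intros Ha Hb Hg; apply (ex_RInt_continuous (V := R_CompleteNormedModule)).
intros z Hz.
assert (Hlz : l < z < u).
{ revert Hz; unfold Rmin, Rmax; destruct (Rle_dec a b); lra. }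
apply (continuous_ext (fun t => sqrt (dot (velocity g t) (velocity g t)))).
{ intro t; symmetry; apply norm_E3. }
apply (continuous_comp (fun t => dot (velocity g t) (velocity g t)) sqrt).
- apply (smooth_on_continuous l u); [|assumption].
  apply smooth_on_dot; apply (smooth3_jet l u g 1); assumption.
- apply continuous_sqrt.
Qed.

Lemma RInt_dot_comb (l u a b : R) (f : R -> E3) (p : E3) :
  l < a < u -> l < b < u -> smooth3 l u f ->
  RInt (fun t => dot p (f t)) a b = dot p (vRInt f a b).
Proof.
intros Ha Hb (F1&F2&F3); apply is_RInt_unique.
assert (HR : forall x h, smooth_on l u h ->
  is_RInt (fun t => x * h t) a b (x * RInt h a b)).
{ intros x h Hh; apply (is_RInt_scal h a b x).
  apply (RInt_correct (V := R_CompleteNormedModule)), (ex_RInt_smooth_on l u);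
    assumption. }
apply (is_RInt_plus (V := R_NormedModule)
  (fun t => crd1 p * crd1 (f t) + crd2 p * crd2 (f t))
  (fun t => crd3 p * crd3 (f t))); [|apply HR; assumption].
apply (is_RInt_plus (V := R_NormedModule)
  (fun t => crd1 p * crd1 (f t)) (fun t => crd2 p * crd2 (f t)));
  apply HR; assumption.
Qed.

Section FirstVariation.

Context (l u a b : R) (Hla : l < a) (Hab : a < b) (Hbu : b < u).
Context (x y : R -> E3) (c : R -> R).
Let v t := vsub (x t) (y t).
Let T := velocity x.
Context (Sx : smooth3 l u x) (Sy : smooth3 l u y).
Context (Hy : forall t, a <= t <= b -> velocity y t = vscal (c t) (v t)).
Context (HT : forall t, a <= t <= b -> dot (T t) (T t) = 1).
Context (Hcrit : critical_between a b x y).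

Context (e : R) (He : 0 < e) (V : R -> R -> E3) (C : R -> R -> R).
Context (SV : separable3 e l u V) (SC : separable e l u C).
Context (V0 : forall t, V 0 t = v t) (C0 : forall t, C 0 t = c t).
Context (V1 : forall s t, - e < s < e -> a <= t <= b ->
  dot (V s t) (V s t) = 1).
Context (Va : forall s, V s a = v a) (Vb : forall s, V s b = v b).
Context (HI : forall s, - e < s < e ->
  vRInt (fun t => vscal (C s t) (V s t)) a b =
  vRInt (fun t => vscal (C 0 t) (V 0 t)) a b).
Context (phi : R -> E3) (delta : R -> R).
Context (Dphi : forall t, a <= t <= b -> is_derive3 (fun s => V s t) 0 (phi t)).
Context (Ddelta : forall t, a <= t <= b ->
  is_derive (fun s => C s t) 0 (delta t)).

Let w t := vadd (vscal (delta t) (v t)) (vscal (c t) (phi t)).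

Lemma is_derive3_back_velocity (t : R) : a <= t <= b ->
  is_derive3 (fun s => vscal (C s t) (V s t)) 0 (w t).
Proof.
intros Ht; unfold w; rewrite <- (C0 t), <- (V0 t).
apply (is_derive3_vscal (fun s => C s t) (fun s => V s t)); auto.
Qed.

(** The derivative at s = 0 of the displacement of the back wheel, which does
    not depend on s. *)
Lemma constraint_variation : vRInt w a b = (0, 0, 0).
Proof.
assert (SCV : separable3 e l u (fun s t => vscal (C s t) (V s t)))
  by (apply sep3_vscal; assumption).
destruct SCV as (S1&S2&S3).
assert (K : forall (i : E3 -> R), separable e l u (fun s t => i (vscal (C s t) (V s t))) ->
  (forall t, a <= t <= b -> is_derive (fun s => i (vscal (C s t) (V s t))) 0 (i (w t))) ->
  (forall s, - e < s < e -> RInt (fun t => i (vscal (C s t) (V s t))) a b =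
     RInt (fun t => i (vscal (C 0 t) (V 0 t))) a b) ->
  RInt (fun t => i (w t)) a b = 0).
{ intros i Si Di Ii.
  assert (D := sep_is_derive_RInt e l u a b 0 _ (fun t => i (w t)) Si Hla Hab Hbu
    ltac:(lra) Di).
  rewrite <- (is_derive_unique _ _ _ D).
  apply is_derive_unique.
  apply is_derive_ext_loc with
    (f := fun _ : R => RInt (fun t => i (vscal (C 0 t) (V 0 t))) a b).
  - apply (locally_between (- e) e); [lra|]; intros s Hs.
    symmetry; apply Ii, Hs.
  - apply @is_derive_const. }
apply E3_eq; [apply (K crd1)|apply (K crd2)|apply (K crd3)]; try assumption;
try (intros t Ht; apply is_derive3_back_velocity; assumption); intros s Hs;
[apply (f_equal crd1 (HI s Hs))|apply (f_equal crd2 (HI s Hs))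
|apply (f_equal crd3 (HI s Hs))].
Qed.

(** The speed is not differentiated under the integral sign.  By
    Cauchy-Schwarz the length L(s) is at least G(s), the integral of
    T . X_s', with equality at s = 0 because T is the unit tangent there.  So
    L - G has a minimum at 0, and as L'(0) = 0 by criticality, G'(0) = 0 too.
    Integrating the term T . V_s' by parts turns G, up to a constant, into the
    integral of a family that contains no derivative of V_s. *)
Lemma length_variation :
  RInt (fun t => dot (T t) (w t) - dot (jet 2 x t) (phi t)) a b = 0.
Proof.
assert (Ha : l < a < u) by lra; assert (Hb : l < b < u) by lra.
assert (ST : smooth3 l u T) by (apply (smooth3_jet l u x 1); assumption).
assert (ST' : smooth3 l u (jet 2 x)) by (apply smooth3_jet; assumption).
assert (SCV : separable3 e l u (fun s t => vscal (C s t) (V s t)))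
  by (apply sep3_vscal; assumption).
destruct (sep3_primitive e l u a _ SCV Ha) as (P&SP&EP&DP).
set (Y := fun s t => vadd (y a) (P s t)).
set (X := fun s t => vadd (Y s t) (V s t)).
assert (SY : separable3 e l u Y).
{ apply sep3_vadd; [apply (sep3_snd e l u (fun _ => y a)), smooth3_const|assumption]. }
assert (SX : separable3 e l u X) by (apply sep3_vadd; assumption).
assert (DY : forall s t, l < t < u ->
  is_derive3 (Y s) t (vscal (C s t) (V s t))).
{ intros s t Ht; unfold Y.
  assert (D := is_derive3_vadd (fun _ => y a) (P s) t _ _
    (is_derive3_const (y a) t) (DP s t Ht)).
  replace (vscal (C s t) (V s t)) with
    (vadd (0,0,0) (vscal (C s t) (V s t))); [exact D|].
  generalize (vscal (C s t) (V s t)); veq. }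
assert (DX : forall s t, l < t < u -> velocity (X s) t =
  vadd (vscal (C s t) (V s t)) (velocity (V s) t)).
{ intros s t Ht; apply velocity_unique.
  apply (is_derive3_vadd (Y s) (V s)); [apply DY; assumption|].
  apply (is_derive3_velocity l u); [|assumption].
  apply (sep3_smooth_snd e); assumption. }
assert (Pa : forall s, P s a = (0, 0, 0)).
{ intro s; rewrite EP by assumption; unfold vRInt.
  rewrite !RInt_point; reflexivity. }
(* Y 0 and y have the same velocity on [a, b] and the same value at a. *)
assert (Y0 : forall t, a <= t <= b -> Y 0 t = y t).
{ intros t Ht.
  destruct (Req_dec a t) as [<-|Hne].
  { unfold Y; rewrite Pa; generalize (y a); veq. }
  assert (Q : vsub (Y 0 a) (y a) = vsub (Y 0 t) (y t)).
  { apply (is_derive3_const_eq (fun z => vsub (Y 0 z) (y z))); [lra|].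
    intros z Hz.
    replace (0, 0, 0) with (vsub (vscal (C 0 z) (V 0 z)) (velocity y z)).
    - apply is_derive3_vsub; [apply DY; lra|].
      apply (is_derive3_velocity l u); [assumption|lra].
    - rewrite Hy, V0, C0 by lra; generalize (v z); veq. }
  unfold Y at 1 in Q; rewrite Pa in Q.
  revert Q; generalize (Y 0 t) (y t) (y a); intros p q r Q.
  apply E3_eq; [assert (Q' := f_equal crd1 Q)|assert (Q' := f_equal crd2 Q)
    |assert (Q' := f_equal crd3 Q)]; revert Q'; clear Q; vunfold;
  intros; lra. }
assert (Yb : forall s, - e < s < e -> Y s b = y b).
{ intros s Hs; rewrite <- (Y0 b) by lra; unfold Y.
  rewrite !EP, HI by assumption; reflexivity. }
assert (Ya : forall s, Y s a = y a).
{ intro s; unfold Y; rewrite Pa; generalize (y a); veq. }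
assert (X0 : forall t, a <= t <= b -> X 0 t = x t).
{ intros t Ht; unfold X; rewrite Y0, V0 by assumption; unfold v.
  generalize (x t) (y t); veq. }
assert (HV : bicycle_variation a b x y (mkposreal e He) X Y).
{ split; [|split; [|split]].
  - intros s t Hs Ht; unfold segment in Ht; simpl in Hs; apply Rabs_def2 in Hs.
    split; apply (sep3_smooth_family_at e l u); try assumption; lra.
  - intros s Hs; simpl in Hs; apply Rabs_def2 in Hs.
    split; [|split].
    + apply (smooth3_smooth_curve l u); try assumption.
      apply (sep3_smooth_snd e); assumption.
    + apply (smooth3_smooth_curve l u); try assumption.
      apply (sep3_smooth_snd e); assumption.
    + intros t Ht; unfold segment in Ht.
      assert (EV : minus (X s t : R * R * R) (Y s t) = V s t).
      { change (vsub (X s t) (Y s t) = V s t); unfold X.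
        generalize (Y s t) (V s t); veq. }
      rewrite EV; split.
      * apply norm_eq1_dot, V1; [lra|assumption].
      * exists (C s t); apply velocity_unique, DY; lra.
  - intros s Hs; simpl in Hs; apply Rabs_def2 in Hs.
    assert (Hs' : - e < s < e) by lra.
    assert (XY : forall t, V s t = v t -> Y s t = y t -> X s t = x t).
    { intros t E1 E2; unfold X; rewrite E1, E2; unfold v.
      generalize (x t) (y t); veq. }
    repeat split; auto.
  - intros t Ht; split; [apply X0|apply Y0]; assumption. }
set (f := fun s t => dot (T t) (vscal (C s t) (V s t)) - dot (jet 2 x t) (V s t)).
set (K := dot (T b) (v b) - dot (T a) (v a)).
assert (Sf : separable e l u f).
{ apply sep_minus; apply sep_dot; try assumption; apply sep3_snd; assumption. }
(* Integrating by parts, the boundary terms being the same for every s. *)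
assert (HG : forall s, RInt (f s) a b + K =
   RInt (fun t => dot (T t) (velocity (X s) t)) a b).
{ intros s.
  assert (SVs : smooth3 l u (V s)) by (apply (sep3_smooth_snd e); assumption).
  assert (SVs' : smooth3 l u (velocity (V s)))
    by (apply (smooth3_jet l u (V s) 1); assumption).
  assert (EK : RInt (fun t => dot (jet 2 x t) (V s t) + dot (T t) (velocity (V s) t)) a b = K).
  { apply is_RInt_unique; unfold K; rewrite <- (Va s), <- (Vb s).
    apply (is_RInt_derive (V := R_CompleteNormedModule) (fun t => dot (T t) (V s t))).
    - intros t; rewrite Rmin_left, Rmax_right by lra; intro Ht.
      apply is_derive3_dot.
      + apply (is_derive3_jet l u x 1); [assumption|lra].
      + apply (is_derive3_velocity l u); [assumption|lra].
    - intros t; rewrite Rmin_left, Rmax_right by lra; intro Ht.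
      apply (smooth_on_continuous l u (fun t => dot (jet 2 x t) (V s t) + dot (T t) (velocity (V s) t))); [|lra].
      apply smooth_on_plus; apply smooth_on_dot; assumption. }
  rewrite <- EK.
  rewrite <- (RInt_plus (V := R_CompleteNormedModule) (f s)).
  - apply RInt_ext; rewrite Rmin_left, Rmax_right by lra; intros t Ht.
    rewrite DX by lra; unfold f.
    match goal with |- ?p = ?q => change (@eq R p q) end.
    unfold plus; simpl; generalize (T t) (jet 2 x t) (V s t) (velocity (V s) t).
    vring.
  - apply (ex_RInt_smooth_on l u); try lra.
    apply (sep_smooth_snd e); assumption.
  - apply (ex_RInt_smooth_on l u); try lra.
    apply smooth_on_plus; apply smooth_on_dot; assumption. }
set (L := fun s => curve_length (X s) a b).
assert (DL : is_derive L 0 0) by (apply (Hcrit _ X Y HV)).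
assert (DG : is_derive (fun s => RInt (f s) a b + K) 0
  (RInt (fun t => dot (T t) (w t) - dot (jet 2 x t) (phi t)) a b + 0)).
{ apply (is_derive_plus (fun s => RInt (f s) a b) (fun _ => K));
    [|apply @is_derive_const].
  apply (sep_is_derive_RInt e l u); try assumption; [lra|].
  intros t Ht; unfold f.
  assert (A := is_derive3_dot _ _ 0 _ _ (is_derive3_const (T t) 0) (is_derive3_back_velocity t Ht)).
  assert (B := is_derive3_dot _ _ 0 _ _ (is_derive3_const (jet 2 x t) 0)
    (Dphi t Ht)).
  assert (D := is_derive_minus _ _ 0 _ _ A B).
  match type of D with is_derive _ _ ?d =>
    replace (dot (T t) (w t) - dot (jet 2 x t) (phi t)) with d; [exact D|] end.
  unfold minus, plus, opp; simpl.
  generalize (T t) (w t) (jet 2 x t) (phi t) (vscal (C 0 t) (V 0 t)) (V 0 t).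
  vring. }
rewrite Rplus_0_r in DG.
assert (LG : forall s, RInt (f s) a b + K <= L s).
{ intros s; rewrite HG; unfold L, curve_length.
  assert (SXs : smooth3 l u (X s)) by (apply (sep3_smooth_snd e); assumption).
  apply RInt_le; [lra| | |].
  - apply (ex_RInt_smooth_on l u); try lra; apply smooth_on_dot; [assumption|].
    apply (smooth3_jet l u (X s) 1); assumption.
  - apply (ex_RInt_speed l u); try lra; assumption.
  - intros t Ht; apply dot_le_norm, HT; lra. }
assert (LG0 : RInt (f 0) a b + K = L 0).
{ rewrite HG; unfold L, curve_length.
  apply RInt_ext; rewrite Rmin_left, Rmax_right by lra; intros t Ht.
  assert (E : velocity (X 0) t = T t).
  { apply velocity_unique.
    apply (is_derive3_ext_loc a b x); [assumption| |].
    - intros z Hz; symmetry; apply X0; lra.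
    - apply (is_derive3_velocity l u); [assumption|lra]. }
  unfold speed; rewrite E, HT by lra; symmetry.
  apply norm_eq1_dot, HT; lra. }
assert (D := is_derive_minus _ _ 0 _ _ DL DG).
apply (is_derive_min_zero _ e) in D; [|assumption|].
- unfold minus, plus, opp in D; simpl in D; lra.
- intros s Hs; unfold minus, plus, opp; simpl; assert (H := LG s); lra.
Qed.

End FirstVariation.

(** * The Euler-Lagrange equation *)
Lemma RInt_zero_nonneg (l u a b : R) (f : R -> R) :
  l < a -> a < b -> b < u -> smooth_on l u f ->
  (forall t, a < t < b -> 0 <= f t) -> RInt f a b = 0 ->
  forall t, a < t < b -> f t = 0.
Proof.
intros Hla Hab Hbu Sf Hpos H0.
assert (F0 : forall t, a < t < b -> RInt f a t = 0).
{ intros t Ht.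
  assert (Ea : ex_RInt f a t) by (apply (ex_RInt_smooth_on l u); try assumption; lra).
  assert (Eb : ex_RInt f t b) by (apply (ex_RInt_smooth_on l u); try assumption; lra).
  assert (C := RInt_Chasles (V := R_CompleteNormedModule) f a t b Ea Eb).
  rewrite H0 in C; unfold plus in C; simpl in C.
  assert (A := RInt_ge_0 f a t ltac:(lra) Ea ltac:(intros; apply Hpos; lra)).
  assert (B := RInt_ge_0 f t b ltac:(lra) Eb ltac:(intros; apply Hpos; lra)).
  lra. }
intros t Ht.
assert (D := is_derive_primitive l u a t f Sf ltac:(lra) ltac:(lra)).
rewrite <- (is_derive_unique _ _ _ D); apply is_derive_unique.
apply is_derive_ext_loc with (f := fun _ : R => 0); [|apply @is_derive_const].
apply (locally_between a b); [assumption|]; intros; symmetry; auto.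
Qed.

(** A positive definite symmetric matrix is invertible.  The test
    vectors are the cofactors along the last row of each leading block, at
    which the quadratic form is the product of two consecutive leading
    minors. *)
Lemma gram_det_neq0 (m1 m2 m3 : E3) :
  crd2 m1 = crd1 m2 -> crd3 m1 = crd1 m3 -> crd3 m2 = crd2 m3 ->
  (forall n, n <> (0, 0, 0) ->
    0 < dot n (vadd (vscal (crd1 n) m1)
                 (vadd (vscal (crd2 n) m2) (vscal (crd3 n) m3)))) ->
  det3 m1 m2 m3 <> 0.
Proof.
destruct m1 as [[A B] C], m2 as [[B' D] E], m3 as [[C' E'] F].
cbn [crd1 crd2 crd3 fst snd]; intros <- <- <- Hpos.
assert (P : forall n1 n2 n3, n1 <> 0 \/ n2 <> 0 \/ n3 <> 0 ->
  0 < A*n1*n1 + D*n2*n2 + F*n3*n3 + 2*B*n1*n2 + 2*C*n1*n3 + 2*E*n2*n3).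
{ intros n1 n2 n3 Hn; eapply Rlt_le_trans; [apply (Hpos (n1, n2, n3))|].
  - intro H; injection H; intros; tauto.
  - right; vunfold; ring. }
clear Hpos.
assert (HA : 0 < A).
{ generalize (P 1 0 0 ltac:(left; lra)); lra. }
assert (HD : 0 < A * D - B * B).
{ generalize (P (- B) A 0 ltac:(right; left; lra)); intro H.
  apply (Rmult_lt_reg_l A); [assumption|]; lra. }
assert (HF := P (B*E - C*D) (B*C - A*E) (A*D - B*B) ltac:(right; right; lra)).
intro H; revert HF; apply Rle_not_lt, Req_le.
transitivity ((A*D - B*B) * det3 (A, B, C) (B, D, E) (C, E, F)).
- vunfold; ring.
- rewrite H; ring.
Qed.

Section EulerLagrange.

Context (l u a b : R) (Hla : l < a) (Hab : a < b) (Hbu : b < u).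
Context (x y : R -> E3) (c : R -> R).
Let v t := vsub (x t) (y t).
Let T := velocity x.
Context (Sx : smooth3 l u x) (Sy : smooth3 l u y) (Sc : smooth_on l u c).
Context (Hv : forall t, a <= t <= b -> dot (v t) (v t) = 1).
Context (Hy : forall t, a <= t <= b -> velocity y t = vscal (c t) (v t)).
Context (HT : forall t, a <= t <= b -> dot (T t) (T t) = 1).
Context (Hspan : forall n, (forall t, a < t < b -> dot n (v t) = 0) ->
  n = (0, 0, 0)).

Let Sv : smooth3 l u v.
Proof. apply smooth3_vsub; assumption. Qed.
Let ST : smooth3 l u T.
Proof. apply (smooth3_jet l u x 1); assumption. Qed.
Let Ha : l < a < u. Proof. lra. Qed.
Let Hb : l < b < u. Proof. lra. Qed.

Lemma moment_comb (n : E3) :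
  vadd (vscal (crd1 n) (moment v v a b crd1))
   (vadd (vscal (crd2 n) (moment v v a b crd2))
         (vscal (crd3 n) (moment v v a b crd3)))
  = vRInt (fun t => vscal (dot n (v t)) (v t)) a b.
Proof.
assert (E := vRInt_comb l u a b (fun _ => 0) v v n Ha Hb
  (smooth_on_const l u 0) Sv Sv).
assert (Z : vRInt (fun t => vscal 0 (v t)) a b = (0, 0, 0)).
{ assert (Z : forall f : R -> R, RInt (fun t => 0 * f t) a b = 0).
  { intro f; rewrite (RInt_ext _ (fun _ => 0)).
    - rewrite RInt_const; apply Rmult_0_r.
    - intros; apply Rmult_0_l. }
  apply E3_eq; apply Z. }
cbv beta in E; rewrite Z in E.
replace (fun t => vscal (dot n (v t)) (v t)) with
  (fun t => vscal (0 + dot n (v t)) (v t)).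
- rewrite E.
  generalize (moment v v a b crd1) (moment v v a b crd2) (moment v v a b crd3).
  veq.
- apply functional_extensionality; intro t; rewrite Rplus_0_l; reflexivity.
Qed.

(** For a constant n, the quadratic form of the moments at n is the integral
    of (n . v)^2, positive since v spans the space. *)
Lemma moment_det_neq0 :
  det3 (moment v v a b crd1) (moment v v a b crd2) (moment v v a b crd3) <> 0.
Proof.
assert (Sym : forall i j : E3 -> R, RInt (fun t => i (v t) * j (v t)) a b =
  RInt (fun t => j (v t) * i (v t)) a b).
{ intros i j; apply RInt_ext; intros; apply Rmult_comm. }
apply gram_det_neq0.
- apply (Sym crd1 crd2).
- apply (Sym crd1 crd3).
- apply (Sym crd2 crd3).
- intros n Hn; rewrite moment_comb.
  assert (Sn : smooth_on l u (fun t => dot n (v t)))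
    by (apply (smooth_on_dot l u (fun _ => n)); [apply smooth3_const|assumption]).
  rewrite <- (RInt_dot_comb l u) by (try apply smooth3_vscal; assumption).
  assert (E : forall t, dot n (vscal (dot n (v t)) (v t)) = (dot n (v t))^2).
  { intro t; generalize (v t); vring. }
  assert (S2 : smooth_on l u (fun t => dot n (vscal (dot n (v t)) (v t)))).
  { apply (smooth_on_dot l u (fun _ => n)); [apply smooth3_const|].
    apply smooth3_vscal; assumption. }
  assert (H0 : 0 <= RInt (fun t => dot n (vscal (dot n (v t)) (v t))) a b).
  { apply RInt_ge_0; [lra|apply (ex_RInt_smooth_on l u); assumption|].
    intros t _; cbv beta; rewrite E; apply pow2_ge_0. }
  destruct H0 as [H0|H0]; [assumption|exfalso; apply Hn, Hspan].
  intros t Ht.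
  assert (Q := RInt_zero_nonneg l u a b _ Hla Hab Hbu S2
   ltac:(intros z _; cbv beta; rewrite E; apply pow2_ge_0) (eq_sym H0) t Ht).
  cbv beta in Q; rewrite E in Q.
  apply Rsqr_0_uniq; unfold Rsqr; lra.
Qed.

(** Let p be the solution of the Gram system for which T . v and p . v have
    the same integral against every coordinate of v: p is the multiplier of
    the displacement condition.  For a variation with rates g of c and phi of
    v, the first variation becomes the integral of
    ((T - p) . v) g + E . phi, where E = c (T - p) - T', whatever
    the steering correction is.  Taking g = (T - p) . v and phi a nonnegative
    multiple, zero at the ends, of the component of E orthogonal to v makes
    both terms nonnegative, hence zero. *)
Lemma euler_lagrange : critical_between a b x y ->
  exists p : E3, forall t, a < t < b ->
    dot (vsub (T t) p) (v t) = 0 /\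
    exists m, jet 2 x t =
      vadd (vscal (c t) (vsub (T t) p)) (vscal m (v t)).
Proof.
intros Hcrit.
set (R0 := vRInt (fun t => vscal (dot (T t) (v t)) (v t)) a b).
set (p := cramer (moment v v a b crd1) (moment v v a b crd2)
  (moment v v a b crd3) R0).
assert (Hp : vRInt (fun t => vscal (dot p (v t)) (v t)) a b = R0).
{ rewrite <- moment_comb; apply cramer_eq, moment_det_neq0. }
exists p.
set (E := fun t => vsub (vscal (c t) (vsub (T t) p)) (jet 2 x t)).
set (E' := fun t => vsub (E t) (vscal (dot (E t) (v t)) (v t))).
(* h is positive inside the segment and vanishes at both ends, where the
   placements are prescribed. *)
set (h := fun t => (t - a) * (b - t)).
set (g := fun t => dot (vsub (T t) p) (v t)).
set (z := fun t => vscal (h t) (E' t)).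
set (V := fun s t => swing s (v t) (z t)).
assert (ST' : smooth3 l u (jet 2 x)) by (apply smooth3_jet; assumption).
assert (Sq : smooth3 l u (fun t => vsub (T t) p))
  by (apply smooth3_vsub; [|apply smooth3_const]; assumption).
assert (SE : smooth3 l u E)
  by (apply smooth3_vsub; [apply smooth3_vscal|]; assumption).
assert (SE' : smooth3 l u E').
{ apply smooth3_vsub; [assumption|].
  apply smooth3_vscal; [apply smooth_on_dot|]; assumption. }
assert (Sh : smooth_on l u h).
{ apply smooth_on_mult; apply smooth_on_minus;
  solve [apply smooth_on_id|apply smooth_on_const]. }
assert (Sg : smooth_on l u g) by (apply smooth_on_dot; assumption).
assert (Sz : smooth3 l u z) by (apply smooth3_vscal; assumption).
assert (SV : separable3 1 l u V) by (apply sep3_swing; assumption).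
assert (V0 : V 0 = v)
  by (apply functional_extensionality; intro t; apply swing_0).
assert (SC0 : separable 1 l u (fun s t => c t + s * g t)).
{ apply sep_plus; [apply sep_snd; assumption|].
  apply (sep_term 1 l u (fun s => s) g); [apply smooth_on_id|assumption]. }
destruct (steering 1 l u a b _ V ltac:(lra) Ha Hb SC0 SV) as
  (e & M & He & SM & M0 & HI).
{ rewrite V0; apply moment_det_neq0. }
rewrite V0 in HI.
set (C := fun s t => c t + s * g t + dot (M s) (v t)).
assert (C0 : forall t, C 0 t = c t).
{ intro t; unfold C; rewrite M0; generalize (v t) (c t) (g t); vring. }
set (m' := velocity M 0).
set (k := fun t => / (1 + dot (z t) (z t))).
set (phi := fun t => vscal (2 * k t) (z t)).
set (delta := fun t => g t + dot m' (v t)).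
assert (SVe : separable3 e l u V) by (apply (sep3_mono 1); [lra|assumption]).
assert (SCe : separable e l u C).
{ apply sep_plus; [apply (sep_mono 1); [lra|assumption]|].
  apply sep_dot; [apply sep3_fst|apply sep3_snd]; assumption. }
assert (Vunit : forall s t, - e < s < e -> a <= t <= b ->
  dot (V s t) (V s t) = 1).
{ intros s t _ Ht; apply swing_unit; [apply Hv, Ht|].
  unfold z, E'.
  assert (Q := Hv t Ht); revert Q; generalize (v t) (E t) (h t).
  intros w q k' Q.
  transitivity (k' * dot q w * (1 - dot w w)); [vring|rewrite Q; ring]. }
assert (za : z a = (0, 0, 0)).
{ unfold z, h; rewrite Rminus_diag, Rmult_0_l; generalize (E' a); veq. }
assert (zb : z b = (0, 0, 0)).
{ unfold z, h; rewrite Rminus_diag, Rmult_0_r; generalize (E' b); veq. }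
assert (Va : forall s, V s a = v a).
{ intro s; unfold V; rewrite za; apply swing_fix. }
assert (Vb : forall s, V s b = v b).
{ intro s; unfold V; rewrite zb; apply swing_fix. }
assert (HI' : forall s, - e < s < e ->
  vRInt (fun t => vscal (C s t) (V s t)) a b =
  vRInt (fun t => vscal (C 0 t) (V 0 t)) a b).
{ intros s Hs; unfold C; rewrite (HI s Hs), V0.
  f_equal; apply functional_extensionality; intro t; f_equal.
  rewrite M0; generalize (v t) (c t) (g t); vring. }
assert (Dphi : forall t, a <= t <= b ->
  is_derive3 (fun s => V s t) 0 (phi t)) by (intros; apply is_derive3_swing).
assert (Ddelta : forall t, a <= t <= b ->
  is_derive (fun s => C s t) 0 (delta t)).
{ intros t _; unfold C, delta.
  apply (is_derive_plus (fun s => c t + s * g t) (fun s => dot (M s) (v t))).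
  - auto_derive; [tauto|ring].
  - assert (D := is_derive3_dot M (fun _ => v t) 0 m' _
      (is_derive3_velocity (- e) e M 0 SM ltac:(lra)) (is_derive3_const _ 0)).
    replace (dot m' (v t)) with (dot m' (v t) + dot (M 0) (0, 0, 0));
      [exact D|].
    generalize (M 0) (v t) m'; vring. }
assert (V0' : forall t, V 0 t = v t) by (intro; rewrite V0; reflexivity).
set (w := fun t => vadd (vscal (delta t) (v t)) (vscal (c t) (phi t))).
assert (I1 : vRInt w a b = (0, 0, 0)).
{ apply (constraint_variation l u a b Hla Hab Hbu x y c e ltac:(lra) V C);
  assumption. }
assert (I2 : RInt (fun t => dot (T t) (w t) - dot (jet 2 x t) (phi t)) a b = 0).
{ apply (length_variation l u a b Hla Hab Hbu x y c Sx Sy Hy HT Hcrit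
    e ltac:(lra) V C); assumption. }
assert (Sk : smooth_on l u k) by (apply smooth_on_swing_factor; assumption).
assert (Sphi : smooth3 l u phi).
{ apply smooth3_vscal; [|assumption].
  apply smooth_on_mult; [apply smooth_on_const|assumption]. }
assert (Sw : smooth3 l u w).
{ apply smooth3_vadd; apply smooth3_vscal; try assumption.
  apply smooth_on_plus; [assumption|].
  apply (smooth_on_dot l u (fun _ => m')); [apply smooth3_const|assumption]. }
assert (Spv : forall q, smooth3 l u q -> smooth3 l u (fun t => vscal (dot (q t) (v t)) (v t))).
{ intros; apply smooth3_vscal; [apply smooth_on_dot|]; assumption. }
assert (Sc1 : forall q f, smooth3 l u f -> smooth_on l u (fun t => dot q (f t))).
{ intros q f Sf; apply (smooth_on_dot l u (fun _ => q)); [apply smooth3_const|assumption]. }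
assert (Key := RInt_comb l u a b 1 (-1) (-1) 1 _ _ _ _ Ha Hb
  (smooth_on_minus l u _ _ (smooth_on_dot l u T w ST Sw)
     (smooth_on_dot l u _ _ ST' Sphi))
  (Sc1 p w Sw) (Sc1 m' _ (Spv T ST)) (Sc1 m' _ (Spv _ (smooth3_const l u p)))).
cbv beta in Key.
rewrite (RInt_dot_comb l u a b w p Ha Hb Sw), I1, I2 in Key.
rewrite (RInt_dot_comb l u a b _ m' Ha Hb (Spv T ST)) in Key.
rewrite (RInt_dot_comb l u a b _ m' Ha Hb (Spv _ (smooth3_const l u p))) in Key.
rewrite Hp in Key; fold R0 in Key.
replace (dot p (0, 0, 0)) with 0 in Key by vring.
assert (Z : RInt (fun t => (g t)^2 + 2 * k t * h t * dot (E' t) (E' t)) a b = 0).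
{ apply (@eq_trans R _ (1 * 0 + (-1 * 0 + (-1 * dot m' R0 + 1 * dot m' R0))));
  [|ring].
  rewrite <- Key; apply RInt_ext; rewrite Rmin_left, Rmax_right by lra.
  intros t Ht; match goal with |- ?A = ?B => change (@eq R A B) end.
  assert (Q := Hv t ltac:(lra)).
  assert (Q' : dot (E' t) (E' t) = dot (E t) (E' t)).
  { unfold E'; revert Q; generalize (v t) (E t); intros n q Q.
    transitivity (dot q (vsub q (vscal (dot q n) n))
      + (dot q n)^2 * (dot n n - 1)); [vring|rewrite Q; ring]. }
  rewrite Q'; unfold w, delta, phi, z, g; unfold E at 1.
  generalize (E' t) (v t) (T t) (jet 2 x t) (c t) (k t) (h t).
  vring. }
assert (Spos : forall t, a < t < b -> 0 < 2 * k t * h t).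
{ intros t Ht.
  assert (K : 0 < k t).
  { apply Rinv_0_lt_compat; assert (H := dot_self_ge0 (z t)); lra. }
  assert (H : 0 < h t) by (apply Rmult_lt_0_compat; lra).
  assert (0 < k t * h t) by (apply Rmult_lt_0_compat; assumption); lra. }
intros t Ht.
assert (Zt : (g t)^2 + 2 * k t * h t * dot (E' t) (E' t) = 0).
{ apply (RInt_zero_nonneg l u a b
    (fun t => (g t)^2 + 2 * k t * h t * dot (E' t) (E' t)));
    try assumption.
  - apply smooth_on_plus.
    + apply smooth_on_mult; [assumption|].
      apply smooth_on_mult; [assumption|apply smooth_on_const].
    + apply smooth_on_mult; [|apply smooth_on_dot; assumption].
      apply smooth_on_mult; [|assumption].
      apply smooth_on_mult; [apply smooth_on_const|assumption].
  - intros t' Ht'; apply Rplus_le_le_0_compat; [apply pow2_ge_0|].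
    apply Rmult_le_pos; [apply Rlt_le, Spos, Ht'|apply dot_self_ge0]. }
assert (G2 := pow2_ge_0 (g t)).
assert (Kh := Spos t Ht).
assert (E2 := dot_self_ge0 (E' t)).
assert (P2 := Rmult_le_pos _ _ (Rlt_le _ _ Kh) E2).
split.
- apply Rsqr_0_uniq; unfold Rsqr; fold (g t); lra.
- assert (E0 : dot (E' t) (E' t) = 0).
  { apply (Rmult_eq_reg_l (2 * k t * h t)); lra. }
  apply dot_self_eq0 in E0.
  exists (- dot (E t) (v t)).
  unfold E' in E0; revert E0; unfold E at 1; generalize (dot (E t) (v t)).
  generalize (jet 2 x t) (v t) (vscal (c t) (vsub (T t) p)).
  intros j n q r E0.
  apply E3_eq; [assert (Q := f_equal crd1 E0)|assert (Q := f_equal crd2 E0)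
    |assert (Q := f_equal crd3 E0)]; revert Q; clear; vunfold;
    intros; lra.
Qed.

End EulerLagrange.

(** * Normal extremals of bicycle paths *)
Lemma is_derive_const_on (a b k t d : R) (f : R -> R) :
  (forall z, a < z < b -> f z = k) -> a < t < b -> is_derive f t d -> d = 0.
Proof.
intros Hf Ht D; rewrite <- (is_derive_unique _ _ _ D); apply is_derive_unique.
apply is_derive_ext_loc with (f := fun _ : R => k); [|apply @is_derive_const].
apply (locally_between a b); [assumption|]; intros; symmetry; auto.
Qed.

Lemma derive_zero_const (a b : R) (f : R -> R) :
  (forall t, a < t < b -> is_derive f t 0) ->
  forall t t', a < t < b -> a < t' < b -> f t = f t'.
Proof.
intros D.
assert (H : forall t t', a < t < b -> a < t' < b -> t < t' -> f t = f t').
{ intros t t' Ht Ht' Hlt; apply (eq_is_derive f t t'); [|assumption].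
  intros z Hz; apply D; lra. }
intros t t' Ht Ht'; destruct (Rtotal_order t t') as [L|[->|L]].
- apply H; assumption.
- reflexivity.
- symmetry; apply H; assumption.
Qed.

Lemma derive_zero_const_closed (l u a b : R) (f : R -> R) :
  l < a -> b < u -> smooth_on l u f ->
  (forall t, a < t < b -> is_derive f t 0) ->
  forall t, a <= t <= b -> f t = f a.
Proof.
intros Hla Hbu Sf D t [[Hat| <-] Htb]; [|reflexivity].
destruct (MVT_gen f a t (fun _ => 0)) as (z & _ & Hz).
- rewrite Rmin_left, Rmax_right by lra; intros w Hw; apply D; lra.
- rewrite Rmin_left, Rmax_right by lra; intros w Hw.
  apply continuity_pt_filterlim, (smooth_on_continuous l u); [assumption|lra].
- lra.
Qed.

(** Uniqueness for f' = k f, by the integrating factor. *)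
Lemma linear_ode_solution (l u a b t0 : R) (k f : R -> R) :
  l < a -> b < u -> smooth_on l u k ->
  (forall t, a < t < b -> is_derive f t (k t * f t)) ->
  a < t0 < b -> forall t, a < t < b -> f t = f t0 * exp (RInt k t0 t).
Proof.
intros Hla Hbu Sk D Ht0 t Ht.
assert (E : forall z, a < z < b -> is_derive
  (fun s => f s * exp (- RInt k t0 s)) z 0).
{ intros z Hz.
  assert (DI := is_derive_primitive l u t0 z k Sk ltac:(lra) ltac:(lra)).
  assert (DE : is_derive (fun s => exp (- RInt k t0 s)) z
    (- k z * exp (- RInt k t0 z))).
  { apply (is_derive_comp exp (fun s => - RInt k t0 s));
      [apply is_derive_exp|apply (is_derive_opp (fun s => RInt k t0 s)), DI]. }
  assert (Q := is_derive_mult f (fun s => exp (- RInt k t0 s)) z _ _ (D z Hz) DE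
    ltac:(intros; apply Rmult_comm)).
  match type of Q with is_derive _ _ ?d => replace 0 with d; [exact Q|] end.
  unfold plus, mult; simpl; ring. }
assert (C := derive_zero_const a b _ E t t0 Ht Ht0); cbv beta in C.
rewrite RInt_point in C; unfold zero in C; simpl in C.
rewrite Ropp_0, exp_0, Rmult_1_r in C; rewrite <- C.
rewrite Rmult_assoc, <- exp_plus, Rplus_opp_l, exp_0; ring.
Qed.

Lemma exists_orthogonal (p : E3) : exists n, n <> (0, 0, 0) /\ dot n p = 0.
Proof.
destruct p as [[p1 p2] p3].
destruct (Req_dec p1 0) as [H1|H1].
- exists (1, 0, 0); split; [intro H; injection H; lra|].
  vunfold; rewrite H1; ring.
- exists (- p2, p1, 0); split; [intro H; injection H; lra|vunfold; ring].
Qed.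

(** A direction normal to the velocity at interior times is normal to the
    whole arc, by the mean value theorem. *)
Lemma planar_of_normal (l u a b : R) (x : R -> E3) (n : E3) :
  l < a -> a < b -> b < u -> smooth3 l u x -> n <> (0, 0, 0) ->
  (forall t, a < t < b -> dot n (velocity x t) = 0) -> planar (segment a b) x.
Proof.
intros Hla Hab Hbu Sx Hn H.
exists n, (dot n (x a)); split; [assumption|].
apply (derive_zero_const_closed l u a b (fun t => dot n (x t)));
  [assumption|assumption| |].
- apply (smooth_on_dot l u (fun _ => n)); [apply smooth3_const|assumption].
- intros t Ht.
  assert (D := is_derive3_dot _ x t _ _ (is_derive3_const n t)
   (is_derive3_velocity l u x t Sx ltac:(lra))).
  rewrite H in D by assumption.
  replace 0 with (dot (0, 0, 0) (x t) + 0); [exact D|].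
  generalize (x t); vring.
Qed.

(** The Hamiltonian equations of paths of critical length: p is the
    constant momentum conjugate to x, and T - p is the momentum conjugate to
    v. *)
Definition normal_extremal (a b : R) (x v : R -> E3) (p : E3) : Prop :=
  forall t, a < t < b ->
    dot (v t) (v t) = 1 /\ dot (velocity x t) (velocity x t) = 1 /\
    dot (vsub (velocity x t) p) (v t) = 0 /\
    is_derive3 v t (vsub (velocity x t) (vscal (dot p (v t)) (v t))) /\
    jet 2 x t =
      vsub (vscal (dot p (v t)) (vsub (velocity x t) p))
           (vscal (dot (vsub (velocity x t) p) (velocity x t)) (v t)).

(** Only the two ends of the segment need an extension: smoothness at a
    point is smoothness near it. *)
Lemma smooth_at_extend (a b : R) (f : R -> R) : a < b ->
  (forall t, a <= t <= b -> smooth_at f t) ->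
  exists d, 0 < d /\ smooth_on (a - d) (b + d) f.
Proof.
intros Hab H.
destruct (H a ltac:(lra)) as [d1 H1]; destruct (H b ltac:(lra)) as [d2 H2].
exists (Rmin d1 d2); split; [apply Rmin_pos; [apply d1|apply d2]|].
assert (A := Rmin_l d1 d2); assert (B := Rmin_r d1 d2).
intros t Ht n.
destruct (Rlt_le_dec t a) as [L|L]; [|destruct (Rlt_le_dec b t) as [L'|L']].
- apply H1; change (Rabs (t - a) < d1); apply Rabs_def1; lra.
- apply H2; change (Rabs (t - b) < d2); apply Rabs_def1; lra.
- assert (Q := H t ltac:(lra)); exact (locally_singleton _ _ Q n).
Qed.

Lemma smooth_curve_extend (J : R -> Prop) (a b : R) (g : R -> E3) :
  is_interval J -> J a -> J b -> a < b -> smooth_curve J g ->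
  exists d, 0 < d /\ smooth3 (a - d) (b + d) g.
Proof.
intros HJ Ja Jb Hab Hg.
assert (H : forall t, a <= t <= b -> J t) by (intros; apply (HJ a b); assumption).
destruct (smooth_at_extend a b (fun t => crd1 (g t)) Hab) as (d1&P1&S1);
  [intros; apply Hg, H; assumption|].
destruct (smooth_at_extend a b (fun t => crd2 (g t)) Hab) as (d2&P2&S2);
  [intros; apply Hg, H; assumption|].
destruct (smooth_at_extend a b (fun t => crd3 (g t)) Hab) as (d3&P3&S3);
  [intros; apply Hg, H; assumption|].
exists (Rmin d1 (Rmin d2 d3)).
assert (A := Rmin_l d1 (Rmin d2 d3)); assert (B := Rmin_r d1 (Rmin d2 d3)).
assert (C := Rmin_l d2 d3); assert (D := Rmin_r d2 d3).
split; [repeat apply Rmin_pos; assumption|].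
split; [|split].
- apply (smooth_on_mono (a - d1) (b + d1)); [lra|lra|assumption].
- apply (smooth_on_mono (a - d2) (b + d2)); [lra|lra|assumption].
- apply (smooth_on_mono (a - d3) (b + d3)); [lra|lra|assumption].
Qed.

(** It remains to identify the coefficients in [euler_lagrange]: c from the
    derivative of |v|^2 = 1, and the coefficient of v in T' from the
    derivative of (T - p) . v = 0.  Nonplanarity enters because a direction
    n orthogonal to v at all times would be orthogonal to v' and to y' = c v,
    and so to T. *)
Lemma geodesic_normal_extremal (J : R -> Prop) (a b : R) (x y : R -> E3) :
  is_interval J -> J a -> J b -> a < b -> bicycling_geodesic J x y ->
  arc_length_parametrized J x -> ~ planar (segment a b) x ->
  exists l u v p, l < a /\ b < u /\ smooth3 l u x /\ smooth3 l u v /\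
    normal_extremal a b x v p.
Proof.
intros HJ Ja Jb Hab [(Hx & Hy & Hxy) Hcrit] HT Hnp.
destruct (smooth_curve_extend J a b x HJ Ja Jb Hab Hx) as (d1&Hd1&Sx).
destruct (smooth_curve_extend J a b y HJ Ja Jb Hab Hy) as (d2&Hd2&Sy).
assert (A := Rmin_l d1 d2); assert (B := Rmin_r d1 d2).
set (l := a - Rmin d1 d2); set (u := b + Rmin d1 d2).
assert (Hla : l < a) by (unfold l; assert (Q := Rmin_pos _ _ Hd1 Hd2); lra).
assert (Hbu : b < u) by (unfold u; assert (Q := Rmin_pos _ _ Hd1 Hd2); lra).
assert (Sx' : smooth3 l u x)
  by (apply (smooth3_mono (a - d1) (b + d1)); unfold l, u; [lra|lra|assumption]).
assert (Sy' : smooth3 l u y)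
  by (apply (smooth3_mono (a - d2) (b + d2)); unfold l, u; [lra|lra|assumption]).
clearbody l u; clear d1 d2 Hd1 Hd2 Sx Sy A B.
assert (HJt : forall t, a <= t <= b -> J t)
  by (intros; apply (HJ a b); assumption).
set (v := fun t => vsub (x t) (y t)).
set (c := fun t => dot (velocity y t) (v t)).
assert (Sv : smooth3 l u v) by (apply smooth3_vsub; assumption).
assert (SDy : smooth3 l u (velocity y)) by (apply (smooth3_jet l u y 1); assumption).
assert (SDx : smooth3 l u (velocity x)) by (apply (smooth3_jet l u x 1); assumption).
assert (Sc : smooth_on l u c) by (apply smooth_on_dot; assumption).
assert (Hv : forall t, a <= t <= b -> dot (v t) (v t) = 1).
{ intros t Ht; apply norm_eq1_dot, (Hxy t (HJt t Ht)). }
assert (Hyc : forall t, a <= t <= b -> velocity y t = vscal (c t) (v t)).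
{ intros t Ht; destruct (Hxy t (HJt t Ht)) as [_ [k Hk]].
  change (velocity y t = vscal k (v t)) in Hk.
  unfold c; rewrite Hk; assert (Q := Hv t Ht); revert Q.
  generalize (v t); intros w Q.
  replace (dot (vscal k w) w) with (k * dot w w) by vring.
  rewrite Q, Rmult_1_r; reflexivity. }
assert (HT' : forall t, a <= t <= b -> dot (velocity x t) (velocity x t) = 1).
{ intros t Ht; apply norm_eq1_dot; exact (HT t (HJt t Ht)). }
assert (Dv : forall t, a < t < b ->
  is_derive3 v t (vsub (velocity x t) (vscal (c t) (v t)))).
{ intros t Ht; rewrite <- Hyc by lra.
  apply is_derive3_vsub; apply (is_derive3_velocity l u); try assumption; lra. }
assert (Hspan : forall n, (forall t, a < t < b -> dot n (v t) = 0) -> n = (0,0,0)).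
{ intros n Hn; apply NNPP; intro Hn0; apply Hnp.
  apply (planar_of_normal l u a b x n); try assumption.
  intros t Ht.
  assert (D := is_derive3_dot _ v t _ _ (is_derive3_const n t) (Dv t Ht)).
  apply (is_derive_const_on a b 0) in D; [|assumption|assumption].
  assert (Q := Hn t Ht); revert D Q.
  generalize (velocity x t) (v t) (c t); intros p q k D Q.
  transitivity (dot (0, 0, 0) q + dot n (vsub p (vscal k q)) + k * dot n q);
    [vring|rewrite D, Q; ring]. }
destruct (euler_lagrange l u a b Hla Hab Hbu x y c Sx' Sy' Sc Hv Hyc HT' Hspan
  (Hcrit a b Ja Jb Hab)) as [p Hp].
exists l, u, v, p; do 4 (split; [assumption|]).
intros t Ht.
destruct (Hp t Ht) as [Hq [m Hm]]; fold (v t) in Hq, Hm.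
assert (Hvt := Hv t ltac:(lra)); assert (HTt := HT' t ltac:(lra)).
assert (Hc : c t = dot p (v t)).
{ assert (D := is_derive3_dot v v t _ _ (Dv t Ht) (Dv t Ht)).
  apply (is_derive_const_on a b 1) in D; [|intros; apply Hv; lra|assumption].
  revert D Hq Hvt; generalize (velocity x t) (v t) (c t); intros T w k D Hq Hw.
  assert (E : dot (vsub T (vscal k w)) w + dot w (vsub T (vscal k w)) =
    2 * (dot (vsub T p) w + dot p w - k * dot w w)) by vring.
  rewrite E, Hq, Hw in D; lra. }
assert (Dvt := Dv t Ht); rewrite Hc in Dvt, Hm.
do 4 (split; [assumption|]).
assert (DT := is_derive3_vsub _ _ t _ _
  (is_derive3_jet l u x 1 t Sx' ltac:(lra)) (is_derive3_const p t)).
assert (D := is_derive3_dot _ v t _ _ DT Dvt); cbv beta in D.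
apply (is_derive_const_on a b 0) in D; [|intros z Hz; apply Hp, Hz|assumption].
change (jet 1 x t) with (velocity x t) in D.
rewrite Hm in D |- *; revert D Hq Hvt.
generalize (velocity x t) (v t); intros T w D Hq Hw.
assert (E : m = - dot (vsub T p) T).
{ assert (E : dot (vsub (vadd (vscal (dot p w) (vsub T p)) (vscal m w)) (0,0,0)) w
   + dot (vsub T p) (vsub T (vscal (dot p w) w)) =
   m * dot w w + dot (vsub T p) T) by vring.
  rewrite E, Hw in D; lra. }
rewrite E; veq.
Qed.

Section Invariants.

Context (l u a b : R) (Hla : l < a) (Hab : a < b) (Hbu : b < u).
Context (x v : R -> E3) (p : E3).
Context (Sx : smooth3 l u x) (Sv : smooth3 l u v).
Context (Hn : normal_extremal a b x v p).

Let T := velocity x.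
Let q t := vsub (T t) p.
Let alpha t := dot p (v t).
Let beta t := dot (q t) (T t).

Let DT (t : R) : a < t < b -> is_derive3 T t (jet 2 x t).
Proof. intros Ht; apply (is_derive3_jet l u x 1); [assumption|lra]. Qed.

Let Dq (t : R) : a < t < b -> is_derive3 q t (jet 2 x t).
Proof.
intros Ht.
assert (D := is_derive3_vsub _ _ t _ _ (DT t Ht) (is_derive3_const p t)).
replace (jet 2 x t) with (vsub (jet 2 x t) (0, 0, 0)); [exact D|].
generalize (jet 2 x t); veq.
Qed.

Let Dv (t : R) : a < t < b -> is_derive3 v t (vsub (T t) (vscal (alpha t) (v t))).
Proof. intros Ht; apply (Hn t Ht). Qed.

Lemma det_const (t t' : R) : a < t < b -> a < t' < b ->
  det3 p (v t) (q t) = det3 p (v t') (q t').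
Proof.
apply (derive_zero_const a b (fun t => det3 p (v t) (q t))).
clear t t'; intros t Ht.
assert (D := is_derive3_det3 _ _ _ t _ _ _ (is_derive3_const p t) (Dv t Ht)
  (Dq t Ht)); cbv beta in D.
match type of D with is_derive _ _ ?d => replace 0 with d; [exact D|] end.
destruct (Hn t Ht) as (_&_&_&_&->); unfold q, alpha; fold T.
generalize (v t) (T t); vring.
Qed.

(** When d = 0, the vector w = v x q satisfies w' = (p . v) w, hence keeps a
    constant direction, and w . T = d = 0.  If w vanishes, so does q, because
    q is orthogonal to v, and then T = p: the track is a straight line. *)
Lemma det_zero_planar :
  (forall t, a < t < b -> det3 p (v t) (q t) = 0) -> planar (segment a b) x.
Proof.
intros Hd.
set (w := fun t => cross (v t) (q t)).
assert (Dw : forall t, a < t < b -> is_derive3 w t (vscal (alpha t) (w t))).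
{ intros t Ht.
  assert (D := is_derive3_cross _ _ t _ _ (Dv t Ht) (Dq t Ht)).
  match type of D with is_derive3 _ _ ?d =>
    replace (vscal (alpha t) (w t)) with d; [exact D|] end.
  assert (Hdt := Hd t Ht).
  destruct (Hn t Ht) as (Hv&HT&Hq&_&->); revert Hdt Hv Hq.
  unfold w, q, alpha; fold T; generalize (v t) (T t); intros n s H0 H1 H2.
  (* Both p - alpha v and q are orthogonal to the unit vector v, so that their
     cross product is the multiple - det (p, v, q) of v. *)
  assert (E : cross (vsub p (vscal (dot p n) n)) (vsub s p) =
     vadd (vscal (- det3 p n (vsub s p)) n)
    (vadd (vscal (1 - dot n n) (cross p (vsub s p)))
          (vscal (dot (vsub s p) n) (cross p n)))) by veq.
  rewrite H0, H1, H2 in E.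
  transitivity (vadd (vscal (dot p n) (cross n (vsub s p)))
    (cross (vsub p (vscal (dot p n) n)) (vsub s p))); [veq|].
  rewrite E; veq. }
set (t0 := (a + b) / 2).
assert (Ht0 : a < t0 < b) by (unfold t0; lra).
assert (Sal : smooth_on l u alpha)
  by (apply (smooth_on_dot l u (fun _ => p)); [apply smooth3_const|assumption]).
assert (Ew : forall t, a < t < b -> w t = vscal (exp (RInt alpha t0 t)) (w t0)).
{ intros t Ht; apply E3_eq; cbn [vscal crd1 crd2 crd3 fst snd];
  rewrite Rmult_comm;
  [apply (linear_ode_solution l u a b t0 alpha (fun t => crd1 (w t)))
  |apply (linear_ode_solution l u a b t0 alpha (fun t => crd2 (w t)))
  |apply (linear_ode_solution l u a b t0 alpha (fun t => crd3 (w t)))];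
  try assumption; intros z Hz; apply Dw; assumption. }
destruct (classic (w t0 = (0, 0, 0))) as [W0|W0].
- destruct (exists_orthogonal p) as (n & Hn0 & Hnp).
  apply (planar_of_normal l u a b x n); try assumption.
  intros t Ht.
  assert (Wt : w t = (0, 0, 0)) by (rewrite Ew, W0 by assumption; veq).
  assert (Q0 : q t = (0, 0, 0)).
  { apply dot_self_eq0; destruct (Hn t Ht) as (Hv&_&Hq&_).
    transitivity (dot (v t) (v t) * dot (q t) (q t)); [rewrite Hv; ring|].
    transitivity (dot (w t) (w t) + dot (q t) (v t) * dot (q t) (v t));
      [unfold w; generalize (v t) (q t); vring|].
    unfold q at 1 2, T; rewrite Hq, Wt; vring. }
  replace (velocity x t) with (vadd (q t) p)
    by (unfold q, T; generalize (velocity x t); veq).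
  rewrite Q0; transitivity (dot n p); [vring|exact Hnp].
- apply (planar_of_normal l u a b x (w t0)); try assumption.
  intros t Ht; assert (Hdt := Hd t Ht).
  assert (Ex := exp_pos (RInt alpha t0 t)).
  apply (Rmult_eq_reg_l (exp (RInt alpha t0 t))); [|lra].
  transitivity (dot (w t) (velocity x t)).
  + rewrite (Ew t Ht); generalize (w t0) (velocity x t); vring.
  + rewrite Rmult_0_r, <- Hdt; unfold w, q, T.
    generalize (v t) (velocity x t); vring.
Qed.

(** The squared curvature of a curve of unit speed. *)
Definition curvature2 (x : R -> E3) (t : R) : R := dot (jet 2 x t) (jet 2 x t).

Lemma beta_eq (t : R) : beta t = dot p (q t) + dot (q t) (q t).
Proof. unfold beta, q; generalize (T t); vring. Qed.

Lemma unit_speed_eq (t : R) : a < t < b ->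
  1 = dot p p + 2 * dot p (q t) + dot (q t) (q t).
Proof.
intros Ht; destruct (Hn t Ht) as (_&HT&_); rewrite <- HT; unfold q, T.
generalize (velocity x t); vring.
Qed.

(** The square of a determinant is the Gram determinant of its columns; here
    v is a unit vector orthogonal to q. *)
Lemma gram_eq (t : R) : a < t < b ->
  (det3 p (v t) (q t))^2 = dot p p * dot (q t) (q t)
    - (alpha t)^2 * dot (q t) (q t) - (dot p (q t))^2.
Proof.
intros Ht; destruct (Hn t Ht) as (Hv&_&Hq&_); fold T in Hq; fold (q t) in Hq.
unfold alpha; revert Hv Hq; generalize (v t) (q t); intros n r Hv Hq.
transitivity (dot p p * (dot n n * dot r r - dot r n * dot r n)
  - dot p n * (dot p n * dot r r - dot r n * dot p r)
  + dot p r * (dot p n * dot r n - dot n n * dot p r)); [vring|].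
rewrite Hv, Hq; ring.
Qed.

Lemma curvature2_alpha_beta (t : R) : a < t < b ->
  curvature2 x t = (alpha t)^2 * dot (q t) (q t) + (beta t)^2.
Proof.
intros Ht; destruct (Hn t Ht) as (Hv&_&Hq&_&E); unfold curvature2; rewrite E.
fold T in Hq |- *; fold (q t) in Hq |- *; fold (alpha t); fold (beta t).
revert Hv Hq; generalize (v t) (q t) (alpha t) (beta t); intros n r c d Hv Hq.
transitivity (c^2 * dot r r - 2 * c * d * dot r n + d^2 * dot n n); [vring|].
rewrite Hv, Hq; ring.
Qed.

Lemma curvature2_eq (t : R) : a < t < b ->
  curvature2 x t = dot (q t) (q t) - (det3 p (v t) (q t))^2.
Proof.
intros Ht; rewrite curvature2_alpha_beta, gram_eq, beta_eq by assumption.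
assert (U := unit_speed_eq t Ht).
set (Q := dot (q t) (q t)) in *; set (m := dot p (q t)) in *.
set (P := dot p p) in *.
transitivity (Q * (P + 2 * m + Q) - (P * Q - alpha t ^ 2 * Q - m ^ 2)); [ring|].
rewrite <- U; ring.
Qed.

Lemma is_derive_alpha (t : R) : a < t < b -> is_derive alpha t (1 - beta t - (alpha t)^2).
Proof.
intros Ht.
assert (D := is_derive3_dot _ v t _ _ (is_derive3_const p t) (Dv t Ht)).
match type of D with is_derive _ _ ?d =>
  replace (1 - beta t - (alpha t)^2) with d; [exact D|] end.
destruct (Hn t Ht) as (_&HT&_); fold T in HT; rewrite <- HT.
unfold beta, q, alpha; generalize (v t) (T t); vring.
Qed.

Lemma acceleration_dot_q (t : R) : a < t < b -> dot (jet 2 x t) (q t) = alpha t * dot (q t) (q t).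
Proof.
intros Ht; destruct (Hn t Ht) as (_&_&Hq&_&->); fold T in Hq |- *.
fold (q t) in Hq |- *; fold (alpha t); fold (beta t).
revert Hq; generalize (v t) (q t) (alpha t) (beta t); intros n r c d Hq.
transitivity (c * dot r r - d * dot r n); [vring|rewrite Hq; ring].
Qed.

Lemma is_derive_beta (t : R) : a < t < b -> is_derive beta t (alpha t * dot (q t) (q t)).
Proof.
intros Ht; assert (D := is_derive3_dot _ _ t _ _ (Dq t Ht) (DT t Ht)).
match type of D with is_derive _ _ ?d =>
  replace (alpha t * dot (q t) (q t)) with d; [exact D|] end.
rewrite <- (acceleration_dot_q t Ht).
assert (Z : 2 * dot (jet 2 x t) (T t) = 0).
{ assert (D' := is_derive3_dot _ _ t _ _ (DT t Ht) (DT t Ht)).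
  apply (is_derive_const_on a b 1) in D'; [|intros z Hz; apply (Hn z Hz)|assumption].
  rewrite <- D'; generalize (jet 2 x t) (T t); vring. }
revert Z; generalize (jet 2 x t) (T t) (q t); intros j s r Z.
replace (dot j s) with 0 by lra.
transitivity (0 + dot j r); [f_equal|]; vring.
Qed.

Lemma jet3_eq (t : R) : a < t < b ->
  jet 3 x t = vsub
    (vadd (vscal (1 - beta t - (alpha t)^2) (q t)) (vscal (alpha t) (jet 2 x t)))
    (vadd (vscal (alpha t * dot (q t) (q t)) (v t))
          (vscal (beta t) (vsub (T t) (vscal (alpha t) (v t))))).
Proof.
intros Ht; apply (is_derive3_unique (jet 2 x) t);
  [apply (is_derive3_jet l u x 2); [assumption|lra]|].
apply (is_derive3_ext_loc a b
  (fun z => vsub (vscal (alpha z) (q z)) (vscal (beta z) (v z)))); [assumption| |].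
- intros z Hz; symmetry; apply (Hn z Hz).
- apply is_derive3_vsub; apply is_derive3_vscal;
    [apply is_derive_alpha|apply Dq|apply is_derive_beta|apply Dv]; assumption.
Qed.

(** In the frame (p, q, v), T = (1, 1, 0), T' = (0, alpha, - beta) and
    T'' = (- beta, 1 - 2 beta, - alpha |q|^2), so the determinant is
    d (alpha^2 |q|^2 + beta^2 - beta) = d (K - beta). *)
Lemma torsion_det (t : R) : a < t < b ->
  2 * det3 (jet 1 x t) (jet 2 x t) (jet 3 x t) =
  det3 p (v t) (q t)
  * (curvature2 x t - (det3 p (v t) (q t))^2 - 1 + dot p p).
Proof.
intros Ht; rewrite (jet3_eq t Ht).
assert (C := curvature2_alpha_beta t Ht); assert (C' := curvature2_eq t Ht).
assert (B := beta_eq t); assert (U := unit_speed_eq t Ht).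
set (Q := dot (q t) (q t)) in *.
destruct (Hn t Ht) as (_&_&_&_&E); rewrite E; fold T; fold (q t).
fold (alpha t); fold (beta t).
change (jet 1 x t) with (T t).
replace (T t) with (vadd p (q t)) by (unfold q; generalize (T t); veq).
set (d := det3 p (v t) (q t)) in *.
transitivity (2 * (d * (alpha t ^ 2 * Q + beta t ^ 2 - beta t))).
- unfold d; generalize (v t) (q t) (alpha t) (beta t); vring.
- rewrite <- C; replace (beta t) with ((curvature2 x t + d^2 + 1 - dot p p) / 2)
    by lra; field.
Qed.

(** Half the derivative of K = |q|^2 - d^2, computed from q' = T'. *)
Lemma jet2_dot_jet3 (t : R) : a < t < b ->
  dot (jet 2 x t) (jet 3 x t) = alpha t * dot (q t) (q t).
Proof.
intros Ht.
assert (D2 := is_derive3_jet l u x 2 t Sx ltac:(lra)).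
assert (D := is_derive_minus _ _ t _ _
  (is_derive3_dot _ _ t _ _ D2 D2) (is_derive3_dot _ _ t _ _ (Dq t Ht) (Dq t Ht))).
apply (is_derive_const_on a b (- (det3 p (v t) (q t))^2)) in D; [| |assumption].
- unfold minus, plus, opp in D; simpl in D.
  rewrite <- (acceleration_dot_q t Ht).
  revert D; generalize (jet 2 x t) (jet 3 x t) (q t); intros j k r D.
  assert (E : dot k j + dot j k + - (dot j r + dot r j) = 2 * (dot j k - dot j r)) by vring.
  lra.
- intros z Hz; assert (C := curvature2_eq z Hz).
  rewrite (det_const t z Ht Hz).
  unfold minus, plus, opp; simpl; unfold curvature2 in C; rewrite C; ring.
Qed.

End Invariants.

(** * Kirchhoff rods do not rescale *)
(** The invariants of a nonplanar geodesic track, expressed by the derivatives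
    of the track only, so that they can be compared for two different frames
    carrying the same curve up to scale. *)
Definition rod_relations (a b : R) (x : R -> E3) (P d : R) : Prop :=
  d <> 0 /\
  (forall t, a < t < b ->
     2 * det3 (jet 1 x t) (jet 2 x t) (jet 3 x t) =
       d * (curvature2 x t - d^2 - 1 + P) /\
     let Q := curvature2 x t + d^2 in
     4 * (dot (jet 2 x t) (jet 3 x t))^2 =
       4 * Q * (P * Q - d^2) - Q * (1 - Q - P)^2) /\
  ((forall t t', a < t < b -> a < t' < b -> curvature2 x t = curvature2 x t') ->
   forall t, a < t < b -> curvature2 x t = 1).

(** In the last clause a constant curvature gives alpha |q|^2 = 0, and
    |q|^2 = K + d^2 > 0.  So alpha = 0 and 0 = alpha' = 1 - beta, which leaves
    K = beta^2 = 1. *)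
Lemma normal_extremal_rod (l u a b : R) (x v : R -> E3) (p : E3) :
  l < a -> a < b -> b < u -> smooth3 l u x -> smooth3 l u v ->
  normal_extremal a b x v p -> ~ planar (segment a b) x ->
  exists P d, rod_relations a b x P d.
Proof.
intros Hla Hab Hbu Sx Sv Hn Hnp.
set (q := fun t => vsub (velocity x t) p).
set (alpha := fun t => dot p (v t)).
set (t0 := (a + b) / 2); assert (Ht0 : a < t0 < b) by (unfold t0; lra).
set (d := det3 p (v t0) (q t0)).
assert (Hd : forall t, a < t < b -> det3 p (v t) (q t) = d).
{ intros t Ht; apply (det_const l u a b Hla Hbu x v p Sx Hn); assumption. }
assert (d0 : d <> 0).
{ intro d0; apply Hnp, (det_zero_planar l u a b Hla Hab Hbu x v p Sx Sv Hn).
  intros t Ht; rewrite <- d0; apply Hd, Ht. }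
assert (HQ : forall t, a < t < b -> dot (q t) (q t) = curvature2 x t + d^2).
{ intros t Ht; rewrite (curvature2_eq a b x v p Hn t Ht), <- (Hd t Ht).
  unfold q; ring. }
assert (HK : forall t, a < t < b ->
  dot (jet 2 x t) (jet 3 x t) = alpha t * (curvature2 x t + d^2)).
{ intros t Ht; rewrite <- HQ by assumption.
  apply (jet2_dot_jet3 l u a b Hla Hbu x v p Sx Hn t Ht). }
exists (dot p p), d; split; [assumption|split].
- intros t Ht; split.
  + rewrite <- (Hd t Ht).
    apply (torsion_det l u a b Hla Hbu x v p Sx Hn t Ht).
  + cbv zeta; rewrite HK by assumption.
    assert (G : d^2 = dot p p * dot (q t) (q t)
      - (alpha t)^2 * dot (q t) (q t) - (dot p (q t))^2)
      by (rewrite <- (Hd t Ht); apply (gram_eq a b x v p Hn t Ht)).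
    assert (U : 1 = dot p p + 2 * dot p (q t) + dot (q t) (q t))
      by apply (unit_speed_eq a b x v p Hn t Ht).
    rewrite HQ in G, U by assumption.
    set (Q := curvature2 x t + d^2) in *.
    replace (1 - Q - dot p p) with (2 * dot p (q t)) by lra.
    rewrite G; ring.
- intros Hc t Ht.
  assert (A0 : forall z, a < z < b -> alpha z = 0).
  { intros z Hz.
    assert (D2 := is_derive3_jet l u x 2 z Sx ltac:(lra)).
    assert (D := is_derive3_dot _ _ z _ _ D2 D2).
    apply (is_derive_const_on a b (curvature2 x t)) in D;
      [|intros w Hw; apply (Hc w t Hw Ht)|assumption].
    assert (E : dot (jet 3 x z) (jet 2 x z) = dot (jet 2 x z) (jet 3 x z))
      by (generalize (jet 2 x z) (jet 3 x z); vring).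
    rewrite E, HK in D by assumption.
    assert (Q0 := dot_self_ge0 (jet 2 x z)); fold (curvature2 x z) in Q0.
    assert (D2' : 0 < d^2) by (apply pow2_gt_0; assumption).
    apply (Rmult_eq_reg_r (curvature2 x z + d^2)); lra. }
  assert (Da := is_derive_alpha a b x v p Hn t Ht).
  apply (is_derive_const_on a b 0) in Da; [|exact A0|assumption].
  rewrite (curvature2_alpha_beta a b x v p Hn t Ht).
  fold (alpha t) in Da |- *; rewrite A0 in Da |- * by assumption.
  match type of Da with 1 - ?z - _ = _ => replace z with 1 by lra end; ring.
Qed.

Lemma geodesic_rod (J : R -> Prop) (a b : R) (x y : R -> E3) :
  is_interval J -> J a -> J b -> a < b -> bicycling_geodesic J x y ->
  arc_length_parametrized J x -> ~ planar (segment a b) x ->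
  exists P d, rod_relations a b x P d.
Proof.
intros HJ Ja Jb Hab Hg HT Hnp.
destruct (geodesic_normal_extremal J a b x y) as (l&u&v&p&?&?&?&?&?);
  try assumption.
apply (normal_extremal_rod l u a b x v p); assumption.
Qed.

(** Four points of the track that are affinely independent already prevent
    planarity, and they are reached in a bounded time. *)
Lemma nonplanar_segment (J : R -> Prop) (x : R -> E3) :
  ~ planar J x -> exists a b, J a /\ J b /\ a < b /\ ~ planar (segment a b) x.
Proof.
intros Hnp.
assert (Ex : forall n, n <> (0, 0, 0) -> forall k, exists t, J t /\ dot n (x t) <> k).
{ intros n Hn k; apply NNPP; intro H; apply Hnp; exists n, k; split; [assumption|].
  intros t Ht; apply NNPP; intro H'; apply H; exists t; auto. }
assert (e1 : ((1, 0, 0) : E3) <> (0, 0, 0)) by (intro H; injection H; lra).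
destruct (Ex (1, 0, 0) e1 0) as (t0 & J0 & _).
destruct (Ex (1, 0, 0) e1 (dot (1, 0, 0) (x t0))) as (t1 & J1 & H1).
set (u1 := vsub (x t1) (x t0)).
destruct (exists_orthogonal u1) as (n & Hn & Hn1).
destruct (Ex n Hn (dot n (x t0))) as (t2 & J2 & H2).
set (u2 := vsub (x t2) (x t0)).
assert (u10 : u1 <> (0, 0, 0)).
{ intro H; apply H1; assert (Q := f_equal crd1 H); revert Q; unfold u1.
  vunfold; lra. }
assert (C : cross u1 u2 <> (0, 0, 0)).
{ intro H.
  assert (E : vscal (dot u1 u1) u2 = vadd (vscal (dot u1 u2) u1) (cross (cross u1 u2) u1)) by veq.
  assert (Q : dot u1 u1 * dot n u2 = 0).
  { transitivity (dot n (vscal (dot u1 u1) u2)); [vring|].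
    rewrite E, H; transitivity (dot u1 u2 * dot n u1); [vring|].
    rewrite Hn1; ring. }
  apply Rmult_integral in Q; destruct Q as [Q|Q].
  - apply u10, dot_self_eq0, Q.
  - apply H2; revert Q; unfold u2; generalize (x t2) (x t0); intros r s Q.
    transitivity (dot n (vsub r s) + dot n s); [vring|rewrite Q; ring]. }
destruct (Ex _ C (dot (cross u1 u2) (x t0))) as (t3 & J3 & H3).
set (u3 := vsub (x t3) (x t0)).
assert (D : det3 u3 u1 u2 <> 0).
{ intro H; apply H3.
  transitivity (det3 u3 u1 u2 + dot (cross u1 u2) (x t0)); [|rewrite H; ring].
  unfold u3; generalize (x t3) (x t0) u1 u2; vring. }
set (lo := Rmin (Rmin t0 t1) (Rmin t2 t3)).
set (hi := Rmax (Rmax t0 t1) (Rmax t2 t3)).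
assert (Jlo : J lo) by (unfold lo, Rmin; repeat destruct Rle_dec; assumption).
assert (Jhi : J hi) by (unfold hi, Rmax; repeat destruct Rle_dec; assumption).
assert (L1 := Rmin_l (Rmin t0 t1) (Rmin t2 t3)).
assert (L2 := Rmin_r (Rmin t0 t1) (Rmin t2 t3)).
assert (L3 := Rmin_l t0 t1); assert (L4 := Rmin_r t0 t1).
assert (L5 := Rmin_l t2 t3); assert (L6 := Rmin_r t2 t3).
assert (M1 := Rmax_l (Rmax t0 t1) (Rmax t2 t3)).
assert (M2 := Rmax_r (Rmax t0 t1) (Rmax t2 t3)).
assert (M3 := Rmax_l t0 t1); assert (M4 := Rmax_r t0 t1).
assert (M5 := Rmax_l t2 t3); assert (M6 := Rmax_r t2 t3).
fold lo in L1, L2; fold hi in M1, M2.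
exists lo, hi; split; [assumption|split; [assumption|split]].
- assert (lo <= hi) as [Hlt|Heq] by lra; [assumption|exfalso].
  assert (t1 = t0) by lra; subst t1; apply u10; unfold u1.
  generalize (x t0); veq.
- intros (m & k & Hm & H).
  assert (S : forall t, lo <= t <= hi -> dot m (vsub (x t) (x t0)) = 0).
  { intros t Ht; transitivity (dot m (x t) - dot m (x t0));
      [generalize (x t) (x t0); vring|].
    rewrite (H t), (H t0); [ring|unfold segment; lra|unfold segment; lra]. }
  assert (S1 := S t1 ltac:(lra)); assert (S2 := S t2 ltac:(lra)).
  assert (S3 := S t3 ltac:(lra)); fold u1 in S1; fold u2 in S2; fold u3 in S3.
  apply Hm, dot_self_eq0, (Rmult_eq_reg_l (det3 u3 u1 u2)); [|assumption].
  transitivity (dot m u3 * dot m (cross u1 u2) + dot m u1 * dot m (cross u2 u3)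
    + dot m u2 * dot m (cross u3 u1)); [generalize u1 u2 u3; vring|].
  rewrite S1, S2, S3; ring.
Qed.

Lemma jet_rescaled (l u lam : R) (x : R -> E3) (n : nat) (t : R) :
  0 < lam -> smooth3 l u x -> l < t < u ->
  jet n (rescaled lam x) (lam * t) = vscal (lam * (/ lam)^n) (jet n x t).
Proof.
intros Hlam (S1&S2&S3) Ht.
assert (H : forall f : R -> R, smooth_on l u f ->
  Derive_n (fun z => lam * f (z / lam)) n (lam * t) =
  lam * (/ lam)^n * Derive_n f n t).
{ intros f Sf; rewrite Derive_n_scal_l, Rmult_assoc; f_equal.
  rewrite (Derive_n_ext (fun z => f (z / lam)) (fun z => f (/ lam * z)))
    by (intro; f_equal; unfold Rdiv; ring).
  assert (E : / lam * (lam * t) = t) by (field; lra).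
  rewrite Derive_n_comp_scal; [rewrite E; reflexivity|].
  rewrite E; apply (locally_between l u); [assumption|].
  intros z Hz k _; apply Sf, Hz. }
apply E3_eq;
[exact (H _ S1)|exact (H _ S2)|exact (H _ S3)].
Qed.

(** K1 and K2 are two values of the squared curvature, D and S those of
    det (T, T', T'') and of T' . T''.  Comparing the relations of degree one
    in K determines d' and P'; the remaining relation becomes
    r^4 (K + d^2) (1 - r^2) K = 0 for K = K1 and K = K2, one of which is
    not zero. *)
Lemma rod_relations_rescale (P d P' d' r K1 K2 D1 D2 S1 S2 : R) :
  0 < r -> d <> 0 -> 0 <= K1 -> 0 <= K2 -> K1 <> K2 ->
  2 * D1 = d * (K1 - d^2 - 1 + P) -> 2 * D2 = d * (K2 - d^2 - 1 + P) ->
  2 * (r^3 * D1) = d' * (r^2 * K1 - d'^2 - 1 + P') ->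
  2 * (r^3 * D2) = d' * (r^2 * K2 - d'^2 - 1 + P') ->
  (let Q := K1 + d^2 in 4 * S1^2 = 4 * Q * (P * Q - d^2) - Q * (1 - Q - P)^2) ->
  (let Q := K2 + d^2 in 4 * S2^2 = 4 * Q * (P * Q - d^2) - Q * (1 - Q - P)^2) ->
  (let Q := r^2 * K1 + d'^2 in
   4 * (r^3 * S1)^2 = 4 * Q * (P' * Q - d'^2) - Q * (1 - Q - P')^2) ->
  (let Q := r^2 * K2 + d'^2 in
   4 * (r^3 * S2)^2 = 4 * Q * (P' * Q - d'^2) - Q * (1 - Q - P')^2) ->
  r = 1.
Proof.
cbv zeta; intros Hr Hd P1 P2 HK E1 E2 F1 F2 G1 G2 H1 H2.
assert (Ed : d' = r * d).
{ assert (Z : r^2 * (K1 - K2) * (r * d - d') = 0).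
  { replace (r^2 * (K1 - K2) * (r * d - d')) with
     (r^3 * (d * (K1 - d^2 - 1 + P)) - r^3 * (d * (K2 - d^2 - 1 + P))
      - (d' * (r^2 * K1 - d'^2 - 1 + P') - d' * (r^2 * K2 - d'^2 - 1 + P')))
     by ring.
    rewrite <- E1, <- E2, <- F1, <- F2; ring. }
  apply Rmult_integral in Z; destruct Z as [Z|Z]; [|lra].
  apply Rmult_integral in Z; destruct Z as [Z|Z]; [|lra].
  assert (0 < r^2) by (apply pow_lt; assumption); lra. }
subst d'.
assert (EP : P' = 1 + r^2 * (P - 1)).
{ assert (Z : r * d * (P' - 1 - r^2 * (P - 1)) = 0).
  { replace (r * d * (P' - 1 - r^2 * (P - 1))) with
     (r * d * (r^2 * K1 - (r * d)^2 - 1 + P')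
      - r^3 * (d * (K1 - d^2 - 1 + P))) by ring.
    rewrite <- E1, <- F1; ring. }
  apply Rmult_integral in Z; destruct Z as [Z|Z]; [|lra].
  apply Rmult_integral in Z; destruct Z; lra. }
subst P'.
assert (HZ : forall K S, 0 <= K ->
  4 * S^2 = 4 * (K + d^2) * (P * (K + d^2) - d^2) - (K + d^2) * (1 - (K + d^2) - P)^2 ->
  4 * (r^3 * S)^2 = 4 * (r^2 * K + (r * d)^2) * ((1 + r^2 * (P - 1)) * (r^2 * K + (r * d)^2) - (r * d)^2)
    - (r^2 * K + (r * d)^2) * (1 - (r^2 * K + (r * d)^2) - (1 + r^2 * (P - 1)))^2 ->
  (1 - r) * K = 0).
{ intros K S HK0 A B.
  assert (Z : r^4 * (K + d^2) * (1 + r) * ((1 - r) * K) = 0).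
  { apply (Rmult_eq_reg_l 4); [|lra].
    transitivity (4 * (r^2 * K + (r * d)^2) * ((1 + r^2 * (P - 1)) * (r^2 * K + (r * d)^2) - (r * d)^2)
    - (r^2 * K + (r * d)^2) * (1 - (r^2 * K + (r * d)^2) - (1 + r^2 * (P - 1)))^2
    - r^6 * (4 * (K + d^2) * (P * (K + d^2) - d^2) - (K + d^2) * (1 - (K + d^2) - P)^2)); [ring|].
    rewrite <- A, <- B; ring. }
  assert (0 < d^2) by (apply pow2_gt_0; assumption).
  assert (0 < r^4) by (apply pow_lt; assumption).
  assert (0 < r^4 * (K + d^2) * (1 + r))
    by (apply Rmult_lt_0_compat; [apply Rmult_lt_0_compat|]; lra).
  apply Rmult_integral in Z; destruct Z as [Z|Z]; lra. }
assert (Z1 := HZ _ _ P1 G1 H1); assert (Z2 := HZ _ _ P2 G2 H2).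
apply Rmult_integral in Z1; apply Rmult_integral in Z2.
destruct Z1 as [Z1|Z1]; [lra|]; destruct Z2 as [Z2|Z2]; lra.
Qed.

Theorem proposition3p9 :
  forall (J : R -> Prop) (x : R -> E3) (lam : R),
    is_interval J ->
    geodesic_front_track J x ->
    arc_length_parametrized J x ->
    ~ planar J x ->
    (0 < lam)%R -> lam <> 1%R ->
    ~ geodesic_front_track (rescaled_domain lam J) (rescaled lam x).
Proof.
intros J x lam HJ [y Hy] HT Hnp Hlam Hlam1 [y' Hy'].
destruct (nonplanar_segment J x Hnp) as (a & b & Ja & Jb & Hab & Hnab).
destruct (geodesic_rod J a b x y HJ Ja Jb Hab Hy HT Hnab) as (P & d & Hd & HR & HC).
assert (Hdiv : forall t, lam * t / lam = t) by (intro; field; lra).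
assert (Hmul : forall t, lam * (t / lam) = t) by (intro; field; lra).
assert (Hle : forall s t, s <= t -> s / lam <= t / lam).
{ intros s t H; apply Rmult_le_compat_r; [|assumption].
  apply Rlt_le, Rinv_0_lt_compat, Hlam. }
assert (HJ' : is_interval (rescaled_domain lam J)).
{ intros s s' t Js Js' Ht; apply (HJ (s / lam) (s' / lam)); [exact Js|exact Js'|].
  split; apply Hle; lra. }
assert (Jet : forall n t, J t ->
  jet n (rescaled lam x) (lam * t) = vscal (lam * (/ lam)^n) (jet n x t)).
{ intros n t Ht; destruct Hy as [[Hx _] _].
  destruct (Hx t Ht) as (X1&X2&X3).
  destruct (filter_and _ _ X1 (filter_and _ _ X2 X3)) as [e He].
  assert (He' : forall z, t - e < z < t + e -> ball t e z).
  { intros z Hz; change (Rabs (z - t) < e); apply Rabs_def1; lra. }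
  apply (jet_rescaled (t - e) (t + e)); [assumption| |destruct e; simpl; lra].
  split; [|split]; intros z Hz; apply (He z (He' z Hz)). }
assert (HT' : arc_length_parametrized (rescaled_domain lam J) (rescaled lam x)).
{ intros t Ht; rewrite <- (HT (t / lam) Ht).
  assert (E := Jet 1%nat (t / lam) Ht); rewrite Hmul in E.
  unfold speed; change (velocity (rescaled lam x) t) with (jet 1 (rescaled lam x) t).
  rewrite E; f_equal.
  replace (lam * (/ lam)^1) with 1 by (field; lra).
  change (velocity x (t / lam)) with (jet 1 x (t / lam)).
  generalize (jet 1 x (t / lam)); veq. }
assert (Hnab' : ~ planar (segment (lam * a) (lam * b)) (rescaled lam x)).
{ intros (n & k & Hn & H); apply Hnab; exists n, (k / lam); split; [assumption|].
  intros t Ht; rewrite <- (H (lam * t)).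
  - unfold rescaled; rewrite Hdiv.
    change (dot n (x t) = dot n (vscal lam (x t)) / lam).
    replace (dot n (vscal lam (x t))) with (lam * dot n (x t))
      by (generalize (x t); vring).
    field; lra.
  - unfold segment in Ht |- *; split; apply Rmult_le_compat_l; lra. }
destruct (geodesic_rod (rescaled_domain lam J) (lam * a) (lam * b)
  (rescaled lam x) y') as (P' & d' & Hd' & HR' & HC'); try assumption;
  try (unfold rescaled_domain; rewrite Hdiv; assumption).
{ apply Rmult_lt_compat_l; assumption. }
assert (Hin : forall t, a < t < b -> lam * a < lam * t < lam * b).
{ intros t Ht; split; apply Rmult_lt_compat_l; lra. }
assert (HJt : forall t, a < t < b -> J t)
  by (intros; apply (HJ a b); [assumption|assumption|lra]).
set (r := / lam).
assert (Hr : 0 < r) by (apply Rinv_0_lt_compat, Hlam).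
assert (Hr1 : r <> 1).
{ intro E; apply Hlam1; unfold r in E; rewrite <- (Rinv_inv lam), E; field. }
assert (lamr : lam * r = 1) by (unfold r; field; lra).
assert (K' : forall t, a < t < b ->
  curvature2 (rescaled lam x) (lam * t) = r^2 * curvature2 x t).
{ intros t Ht; unfold curvature2; rewrite Jet by (apply HJt, Ht); fold r.
  replace (lam * r^2) with r by (rewrite <- (Rmult_1_l r) at 1; rewrite <- lamr; ring).
  generalize (jet 2 x t); vring. }
assert (J2 : forall t, a < t < b ->
  jet 2 (rescaled lam x) (lam * t) = vscal r (jet 2 x t)).
{ intros t Ht; rewrite Jet by (apply HJt, Ht); fold r; f_equal.
  transitivity (lam * r * r); [ring|rewrite lamr; ring]. }
assert (J3 : forall t, a < t < b ->
  jet 3 (rescaled lam x) (lam * t) = vscal (r^2) (jet 3 x t)).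
{ intros t Ht; rewrite Jet by (apply HJt, Ht); fold r; f_equal.
  transitivity (lam * r * r^2); [ring|rewrite lamr; ring]. }
assert (J1 : forall t, a < t < b ->
  jet 1 (rescaled lam x) (lam * t) = jet 1 x t).
{ intros t Ht; rewrite Jet by (apply HJt, Ht); fold r.
  replace (lam * r^1) with 1 by (rewrite <- lamr; ring).
  generalize (jet 1 x t); veq. }
destruct (classic (exists t1 t2, a < t1 < b /\ a < t2 < b /\
  curvature2 x t1 <> curvature2 x t2)) as [(t1 & t2 & Ht1 & Ht2 & HK)|Hconst].
- assert (HRr : forall t, a < t < b ->
    2 * (r^3 * det3 (jet 1 x t) (jet 2 x t) (jet 3 x t)) =
      d' * (r^2 * curvature2 x t - d'^2 - 1 + P') /\
    let Q := r^2 * curvature2 x t + d'^2 in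
    4 * (r^3 * dot (jet 2 x t) (jet 3 x t))^2 =
      4 * Q * (P' * Q - d'^2) - Q * (1 - Q - P')^2).
  { intros t Ht; assert (H := HR' (lam * t) (Hin t Ht)).
    rewrite K', J1, J2, J3 in H by assumption.
    replace (det3 (jet 1 x t) (vscal r (jet 2 x t)) (vscal (r^2) (jet 3 x t)))
      with (r^3 * det3 (jet 1 x t) (jet 2 x t) (jet 3 x t)) in H
      by (generalize (jet 1 x t) (jet 2 x t) (jet 3 x t); vring).
    replace (dot (vscal r (jet 2 x t)) (vscal (r^2) (jet 3 x t)))
      with (r^3 * dot (jet 2 x t) (jet 3 x t)) in H
      by (generalize (jet 2 x t) (jet 3 x t); vring).
    exact H. }
  destruct (HR t1 Ht1) as [E1 G1], (HR t2 Ht2) as [E2 G2].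
  destruct (HRr t1 Ht1) as [F1 H1], (HRr t2 Ht2) as [F2 H2].
  apply Hr1.
  apply (rod_relations_rescale P d P' d' r (curvature2 x t1) (curvature2 x t2)
    _ _ _ _ Hr Hd (dot_self_ge0 _) (dot_self_ge0 _) HK E1 E2 F1 F2 G1 G2 H1 H2).
- assert (HKc : forall t t', a < t < b -> a < t' < b ->
    curvature2 x t = curvature2 x t').
  { intros t t' Ht Ht'; apply NNPP; intro H; apply Hconst; exists t, t'; auto. }
  set (t0 := (a + b) / 2); assert (Ht0 : a < t0 < b) by (unfold t0; lra).
  assert (E := HC HKc t0 Ht0).
  assert (E' : curvature2 (rescaled lam x) (lam * t0) = 1).
  { apply HC'; [|apply Hin, Ht0].
    assert (HD : forall z, lam * a < z < lam * b ->
      exists t, a < t < b /\ z = lam * t).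
    { intros z Hz; exists (z / lam); split; [|symmetry; apply Hmul].
      rewrite <- (Hmul z) in Hz.
      split; apply (Rmult_lt_reg_l lam); lra. }
    intros z z' Hz Hz'.
    destruct (HD z Hz) as (t & Ht & ->), (HD z' Hz') as (t' & Ht' & ->).
    rewrite !K' by assumption; f_equal; apply HKc; assumption. }
  rewrite K', E in E' by assumption.
  apply Hr1; assert (Z : (r - 1) * (r + 1) = 0) by (ring_simplify; lra).
  apply Rmult_integral in Z; destruct Z; lra.
Qed.
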